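(* Let $\mathcal{O}_d$ be the space of entire functions $f$ such that $|f(x)e^{mx}|\to0$ as $x\to-\infty$ for some $m<1$, and for such $f$ define \[ (\mathfrak{N}f)(x)=\frac{e^{-i\pi x}}{2i\sin(\pi x)\,\Gamma(-x)}\int_{-\infty}^{(0+)}f(s)\,e^{s}(-s)^{-x-1}\,ds . \] Then $\mathfrak{N}$ is $\mathbb{C}$-linear and, for every $f\in\mathcal{O}_d$, \[ \mathfrak{N}(f')(x)=(\mathfrak{N}f)(x+1)-(\mathfrak{N}f)(x),\qquad \mathfrak{N}(sf)(x)=x\,(\mathfrak{N}f)(x-1), \] i.e. $\mathfrak{N}$ is left linear over the Weyl algebra $\mathbb{C}\langle X,\partial\rangle$ when the source carries the action $\partial f=f'$, $Xf(x)=xf(x)$ and the target carries the action $\partial g(x)=g(x+1)-g(x)$, $Xg(x)=xg(x-1)$.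
   Context: The integral $\int_{-\infty}^{(0+)}$ is over a Hankel contour starting at $-\infty$ below the negative real axis, circling the origin counterclockwise, and returning to $-\infty$ above the negative real axis, with the branch of $(-s)^{-x-1}$ determined by $|\arg(-s)|<\pi$ (principal branch) on the contour.
   Formalization: The branch of (-s)^{-x-1} is the continuous one, arg(-s)=arg(s)-π, since the principal branch jumps on the contour and the first identity then fails for f=1; x is non-integer, where the formula is defined; Weyl linearity is stated as the two identities, as O_d is not closed under ∂. *)

(* Defs.v *)
From Stdlib Require Import Reals Factorial ZArith.
From Coquelicot Require Import Coquelicot.
Open Scope R_scope.

Definition Ci : C := (0%R, 1%R).
Definition Cexp (z : C) : C :=
  (exp (Re z) * cos (Im z), exp (Re z) * sin (Im z))%R.
Definition Csin (z : C) : C :=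
  ((Cexp (Ci * z) - Cexp (- (Ci * z))) / (2 * Ci))%C.

Definition Cpowr (a : R) (z : C) : C := Cexp (z * RtoC (ln a))%C.

(** The complex Gamma function via Euler/Gauss' limit formula
    Gamma z = lim_n n! n^z / (z (z+1) ... (z+n)),  z not in {0,-1,-2,...}. *)
Fixpoint poch_prod (z : C) (n : nat) : C :=
  match n with
  | O => z
  | S k => (poch_prod z k * (z + RtoC (INR (S k))))%C
  end.
Definition Gamma_seq (z : C) (n : nat) : C :=
  (RtoC (INR (Factorial.fact n)) * Cpowr (INR n) z / poch_prod z n)%C.
Definition CGamma (z : C) : C := lim (T := C_CompleteNormedModule) (filtermap (Gamma_seq z) eventually).

Definition entire (f : C -> C) : Prop :=
  forall z : C, ex_derive (K := C_AbsRing) (V := C_NormedModule) f z.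

Definition in_Od (f : C -> C) : Prop :=
  entire f /\
  exists m : R, m < 1 /\
    is_lim (fun t : R => Cmod (f (RtoC t)) * exp (m * t)) m_infty 0.

(** Integrand f(s) e^s (-s)^{-x-1}, where [a] is the (continuous) argument of
    [s] along the Hankel contour and arg(-s) := a - PI. *)
Definition hankel_integrand (f : C -> C) (x s : C) (a : R) : C :=
  (f s * Cexp s *
   Cexp ((- x - 1) * (RtoC (ln (Cmod s)) + Ci * RtoC (a - PI))))%C.

(** Hankel contour integral \int_{-\infty}^{(0+)} f(s) e^s (-s)^{-x-1} ds,
    on the contour: lower edge of the negative axis from -oo to -1 (arg s = -PI),
    unit circle counterclockwise (s = e^{i th}, th from -PI to PI),
    upper edge of the negative axis from -1 to -oo (arg s = PI). *)
Definition hankel_int (f : C -> C) (x : C) : C :=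
  (RInt_gen (V := C_R_CompleteNormedModule)
      (fun t => hankel_integrand f x (RtoC (- t)) (- PI))
      (at_point 1) (Rbar_locally p_infty)
   + RInt (V := C_R_CompleteNormedModule)
      (fun th => hankel_integrand f x (Cexp (Ci * RtoC th)) th
                 * (Ci * Cexp (Ci * RtoC th)))
      (- PI) PI
   - RInt_gen (V := C_R_CompleteNormedModule)
      (fun t => hankel_integrand f x (RtoC (- t)) PI)
      (at_point 1) (Rbar_locally p_infty))%C.

Definition Nop (f : C -> C) (x : C) : C :=
  (Cexp (- (Ci * RtoC PI * x)) / (2 * Ci * Csin (RtoC PI * x) * CGamma (- x))
   * hankel_int f x)%C.

(** x is not an integer (where the defining formula is literally defined). *)
Definition not_integer (x : C) : Prop := forall n : Z, x <> RtoC (IZR n).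

(* Main.v *)
Require Import Defs.
From Stdlib Require Import Reals Lra Lia Psatz ClassicalEpsilon.
From Coquelicot Require Import Coquelicot.
Open Scope R_scope.

(** Since [d/ds (-s)^(-x-1) = (x+1) (-s)^(-x-2)], integration by parts along the Hankel contour gives
    [H(f')(x) = - H f(x) - (x+1) H f(x+1)], and [s (-s)^(-x-1) = - (-s)^(-x)] gives [H(s f)(x) = - H f(x-1)],
    where [H] is the contour integral. The prefactor [c] satisfies [c(x+1) = - (x+1) c(x)], because
    [Gamma(-x) = - (x+1) Gamma(-x-1)] while both [exp(-i pi x)] and [sin(pi x)] change sign; both identities
    follow. Integrating [f'] requires it to be continuous, which for a merely complex differentiable [f]
    rests on Goursat's theorem and Cauchy's formula, here on the square [[-1,1]^2]. The Gamma recurrence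
    requires the Gauss limit to converge; successive ratios in it are [1 + O(1/n^2)]. *)

(** * Complex-valued functions of a real or complex variable *)

(** The integrals and the limit are total operators with arbitrary values where nothing converges,
    so convergence has to precede any algebra with them. Contour integrals are therefore handled
    through a relation that records the existence of each piece. Its source is exponential
    domination along the rays: half of the margin [1 - m] in the growth condition absorbs the power
    of [t], for every complex exponent. Continuity of [f'] enters because the fundamental theorem of
    calculus for the Riemann integral is applied to a continuous derivative. Cauchy's formula
    appears in an unevaluated form [f w * I w = J w], where [I] and [J] integrate [1 / (s - w)] and
    [f s / (s - w)] around the square. Both are differentiated under the integral sign by an exact
    algebraic remainder, and [I 0 <> 0] permits division. A square is used instead of a circle
    because the bisection behind Goursat's theorem cuts rectangles into rectangles. *)

Lemma norm_C_R (z : C) : norm (V := C_R_NormedModule) z = Cmod z.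
Proof.
  unfold norm; simpl; unfold prod_norm, norm; simpl; unfold abs; simpl.
  unfold Cmod; f_equal.
  pose proof (Rsqr_abs (fst z)); pose proof (Rsqr_abs (snd z)); unfold Rsqr in *; simpl; lra.
Qed.

Lemma Rabs_Re_le (z : C) : Rabs (Re z) <= Cmod z.
Proof. apply Rle_trans with (2 := Rmax_Cmod z), Rmax_l. Qed.

Lemma Rabs_Im_le (z : C) : Rabs (Im z) <= Cmod z.
Proof. apply Rle_trans with (2 := Rmax_Cmod z), Rmax_r. Qed.

Lemma Cmod_le_Re_Im (z : C) : Cmod z <= Rabs (Re z) + Rabs (Im z).
Proof.
  destruct z as [a b]; simpl.
  replace (a, b) with (RtoC a + RtoC b * Ci)%C.
  2:{ unfold RtoC, Ci, Cplus, Cmult; simpl; f_equal; ring. }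
  eapply Rle_trans; [apply Cmod_triangle|].
  rewrite Cmod_mult, Cmod_Ci, !Cmod_R; lra.
Qed.

Lemma C_eq (z w : C) : Re z = Re w -> Im z = Im w -> z = w.
Proof. destruct z, w; simpl; congruence. Qed.

(** Balls of [C_UniformSpace] are squares, the balls of the maximum norm; the factor 2 pays for the
    passage to the modulus. *)
Lemma ball_C (z : C) (e : posreal) (w : C) :
  ball (M := C_UniformSpace) z e w -> Cmod (w - z) < 2 * e.
Proof.
  intros [H1 H2]; eapply Rle_lt_trans; [apply Cmod_le_Re_Im|].
  change (Rabs (fst w - fst z) < e) in H1; change (Rabs (snd w - snd z) < e) in H2.
  unfold Re, Im; simpl; unfold Rminus in *; lra.
Qed.

Lemma Cmod_ball (z : C) (e : R) (w : C) :
  Cmod (w - z) < e -> ball (M := C_UniformSpace) z e w.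
Proof.
  intros H; split.
  - apply Rle_lt_trans with (2 := H), (Rabs_Re_le (w - z)).
  - apply Rle_lt_trans with (2 := H), (Rabs_Im_le (w - z)).
Qed.

Lemma locally_C_Cmod (z : C) (P : C -> Prop) :
  locally (T := C_UniformSpace) z P <->
  exists d, 0 < d /\ forall w, Cmod (w - z) < d -> P w.
Proof.
  split.
  - intros [d Hd]; exists d; split; [apply cond_pos|].
    intros w Hw; apply Hd, Cmod_ball, Hw.
  - intros [d [d0 Hd]]; exists (mkposreal (d / 2) (is_pos_div_2 (mkposreal d d0))).
    intros w Hw; apply Hd; apply ball_C in Hw; simpl in Hw; lra.
Qed.

(** Neighbourhoods over [C_AbsRing] are generated by discs, those of [C_UniformSpace] by squares.
    The epsilon form is a common ground for the two structures, and [locally_C] exchanges them. *)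
Lemma is_derive_C_eps (f : C -> C) (z l : C) :
  is_derive (K := C_AbsRing) (V := C_NormedModule) f z l <->
  forall eps : R, 0 < eps -> exists d, 0 < d /\ forall w, Cmod (w - z) < d ->
    Cmod (f w - f z - l * (w - z)) <= eps * Cmod (w - z).
Proof.
  assert (E : forall w, minus (minus (f w) (f z)) (scal (K := C_AbsRing) (V := C_NormedModule) (minus w z) l)
     = (f w - f z - l * (w - z))%C).
  { intros w; unfold minus, plus, opp, scal; simpl; unfold mult; simpl; ring. }
  split.
  - intros [_ H] eps He.
    specialize (H z (fun P HP => HP) (mkposreal eps He)).
    apply locally_C, locally_C_Cmod in H; destruct H as [d [d0 H]].
    exists d; split; [assumption|]; intros w Hw; specialize (H w Hw).
    rewrite E in H; exact H.
  - intros H; split; [apply is_linear_scal_l|].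
    intros x Hx eps.
    apply (is_filter_lim_locally_unique (V := AbsRing_NormedModule C_AbsRing)) in Hx; subst x.
    apply locally_C, locally_C_Cmod.
    destruct (H eps (cond_pos eps)) as [d [d0 Hd]]; exists d; split; [assumption|].
    intros w Hw; rewrite E; exact (Hd w Hw).
Qed.

Lemma is_derive_R_eps (f : R -> C) (t : R) (l : C) :
  is_derive (K := R_AbsRing) (V := C_R_NormedModule) f t l <->
  forall eps : R, 0 < eps -> exists d, 0 < d /\ forall s, Rabs (s - t) < d ->
    Cmod (f s - f t - l * RtoC (s - t)) <= eps * Rabs (s - t).
Proof.
  assert (E : forall s, minus (minus (f s) (f t)) (scal (K := R_AbsRing) (V := C_R_NormedModule) (minus s t) l)
     = (f s - f t - l * RtoC (s - t))%C).
  { intros w; apply C_eq; unfold minus, plus, opp, scal; simpl; unfold plus, opp, scal; simpl; unfold mult; simpl; ring. }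
  split.
  - intros [_ H] eps He.
    specialize (H t (fun P HP => HP) (mkposreal eps He)).
    destruct H as [d H].
    exists d; split; [apply cond_pos|]; intros w Hw; specialize (H w Hw).
    eapply Rle_trans; [|exact H]; right.
    rewrite <- norm_C_R, <- E; reflexivity.
  - intros H; split; [apply is_linear_scal_l|].
    intros x Hx eps.
    apply (is_filter_lim_locally_unique (V := R_NormedModule)) in Hx; subst x.
    destruct (H eps (cond_pos eps)) as [d [d0 Hd]]; exists (mkposreal d d0).
    intros w Hw; eapply Rle_trans; [|exact (Hd w Hw)]; right.
    rewrite <- norm_C_R, <- E; reflexivity.
Qed.

Lemma is_derive_Re_Im (f : R -> C) (t : R) (l : C) :
  is_derive (K := R_AbsRing) (V := C_R_NormedModule) f t l <->
  is_derive (fun s => Re (f s)) t (Re l) /\ is_derive (fun s => Im (f s)) t (Im l).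
Proof.
  assert (E : forall (g : R -> R) m, is_derive g t m <->
    forall eps : R, 0 < eps -> exists d, 0 < d /\ forall s, Rabs (s - t) < d ->
    Rabs (g s - g t - m * (s - t)) <= eps * Rabs (s - t)).
  { intros g m; assert (E : forall s, minus (minus (g s) (g t)) (scal (minus s t) m) = g s - g t - m * (s - t)).
    { intros s; unfold minus, plus, opp, scal; simpl; unfold mult; simpl; ring. }
    split.
    - intros [_ H] eps He.
      destruct (H t (fun P HP => HP) (mkposreal eps He)) as [d Hd].
      exists d; split; [apply cond_pos|]; intros s Hs; specialize (Hd s Hs).
      rewrite E in Hd; exact Hd.
    - intros H; split; [apply is_linear_scal_l|].
      intros x Hx eps.
      apply (is_filter_lim_locally_unique (V := R_NormedModule)) in Hx; subst x.
      destruct (H eps (cond_pos eps)) as [d [d0 Hd]]; exists (mkposreal d d0).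
      intros w Hw; rewrite E; exact (Hd w Hw). }
  rewrite is_derive_R_eps, 2!E; clear E; split.
  - intros H; split; intros eps He; destruct (H eps He) as [d [d0 Hd]]; exists d; split; auto;
      intros s Hs; apply Rle_trans with (2 := Hd s Hs).
    + replace (Re (f s) - Re (f t) - Re l * (s - t)) with (Re (f s - f t - l * RtoC (s - t))).
      * apply Rabs_Re_le.
      * unfold Re; simpl; ring.
    + replace (Im (f s) - Im (f t) - Im l * (s - t)) with (Im (f s - f t - l * RtoC (s - t))).
      * apply Rabs_Im_le.
      * unfold Im; simpl; ring.
  - intros [H1 H2] eps He.
    destruct (H1 (eps / 2)) as [d1 [d10 Hd1]]; [lra|].
    destruct (H2 (eps / 2)) as [d2 [d20 Hd2]]; [lra|].
    exists (Rmin d1 d2); split; [apply Rmin_pos; assumption|].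
    intros s Hs; eapply Rle_trans; [apply Cmod_le_Re_Im|].
    specialize (Hd1 s (Rlt_le_trans _ _ _ Hs (Rmin_l _ _))).
    specialize (Hd2 s (Rlt_le_trans _ _ _ Hs (Rmin_r _ _))).
    replace (Re (f s - f t - l * RtoC (s - t))) with (Re (f s) - Re (f t) - Re l * (s - t)) by (unfold Re; simpl; ring).
    replace (Im (f s - f t - l * RtoC (s - t))) with (Im (f s) - Im (f t) - Im l * (s - t)) by (unfold Im; simpl; ring).
    lra.
Qed.

Lemma is_derive_Cmult_R (f g : R -> C) (t : R) (df dg : C) :
  is_derive (K := R_AbsRing) (V := C_R_NormedModule) f t df ->
  is_derive (K := R_AbsRing) (V := C_R_NormedModule) g t dg ->
  is_derive (K := R_AbsRing) (V := C_R_NormedModule) (fun s => f s * g s)%C t (df * g t + f t * dg)%C.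
Proof.
  rewrite !is_derive_Re_Im; intros [H1 H2] [H3 H4]; split.
  - apply is_derive_ext with (fun s => minus (mult (Re (f s)) (Re (g s))) (mult (Im (f s)) (Im (g s)))).
    { intros s; unfold minus, plus, opp, mult, Re, Im; simpl; ring. }
    replace (Re (df * g t + f t * dg)) with
      (minus (plus (mult (Re df) (Re (g t))) (mult (Re (f t)) (Re dg)))
             (plus (mult (Im df) (Im (g t))) (mult (Im (f t)) (Im dg)))).
    2:{ unfold minus, plus, opp, mult, Re, Im; simpl; ring. }
    apply (is_derive_minus (K := R_AbsRing) (V := R_NormedModule));
      apply (is_derive_mult (K := R_AbsRing)); auto; intros; apply Rmult_comm.
  - apply is_derive_ext with (fun s => plus (mult (Re (f s)) (Im (g s))) (mult (Im (f s)) (Re (g s)))).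
    { intros s; unfold minus, plus, opp, mult, Re, Im; simpl; ring. }
    replace (Im (df * g t + f t * dg)) with
      (plus (plus (mult (Re df) (Im (g t))) (mult (Re (f t)) (Im dg)))
             (plus (mult (Im df) (Re (g t))) (mult (Im (f t)) (Re dg)))).
    2:{ unfold minus, plus, opp, mult, Re, Im; simpl; ring. }
    apply (is_derive_plus (K := R_AbsRing) (V := R_NormedModule));
      apply (is_derive_mult (K := R_AbsRing)); auto; intros; apply Rmult_comm.
Qed.

Lemma is_derive_RtoC (u : R -> R) (t du : R) :
  is_derive u t du ->
  is_derive (K := R_AbsRing) (V := C_R_NormedModule) (fun s => RtoC (u s)) t (RtoC du).
Proof.
  intros H; apply is_derive_Re_Im; split; simpl; [exact H|].
  apply (is_derive_const (K := R_AbsRing) (V := R_NormedModule) 0).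
Qed.

(** Chain rule with mixed scalars, for a holomorphic function along a real curve. The remainder is
    that of [f] at [g s] plus [l] times that of [g], and each is given half of [eps]. *)
Lemma is_derive_C_comp_R (f : C -> C) (g : R -> C) (t : R) (l m : C) :
  is_derive (K := C_AbsRing) (V := C_NormedModule) f (g t) l ->
  is_derive (K := R_AbsRing) (V := C_R_NormedModule) g t m ->
  is_derive (K := R_AbsRing) (V := C_R_NormedModule) (fun s => f (g s)) t (l * m)%C.
Proof.
  rewrite is_derive_C_eps, !is_derive_R_eps; intros Hf Hg eps He.
  set (M := Cmod m + 1).
  assert (HM : 0 < M) by (unfold M; pose proof (Cmod_ge_0 m); lra).
  set (L := Cmod l + 1).
  assert (HL : 0 < L) by (unfold L; pose proof (Cmod_ge_0 l); lra).
  destruct (Hf (eps / 2 / M)) as [d [d0 Hd]]; [apply Rdiv_lt_0_compat; lra|].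
  (* The entry 1 yields [|g s - g t| <= M * |s - t|], which controls the argument of [f]; the other
     entry bounds [l] times the remainder of [g]. *)
  destruct (Hg (Rmin 1 (eps / 2 / L))) as [c [c0 Hc]].
  { apply Rmin_pos; [lra|]; apply Rdiv_lt_0_compat; lra. }
  exists (Rmin c (d / M)); split; [apply Rmin_pos; auto; apply Rdiv_lt_0_compat; lra|].
  intros s Hs.
  specialize (Hc s (Rlt_le_trans _ _ _ Hs (Rmin_l _ _))).
  assert (Hsd := Rlt_le_trans _ _ _ Hs (Rmin_r _ _)).
  pose proof (Rabs_pos (s - t)) as Ha.
  assert (H1 : Cmod (g s - g t - m * RtoC (s - t)) <= Rabs (s - t)).
  { eapply Rle_trans; [apply Hc|].
    pose proof (Rmin_l 1 (eps / 2 / L)); nra. }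
  assert (H2 : Cmod (g s - g t - m * RtoC (s - t)) <= eps / 2 / L * Rabs (s - t)).
  { eapply Rle_trans; [apply Hc|].
    pose proof (Rmin_r 1 (eps / 2 / L)); nra. }
  assert (H3 : Cmod (g s - g t) <= M * Rabs (s - t)).
  { replace (g s - g t)%C with ((g s - g t - m * RtoC (s - t)) + m * RtoC (s - t))%C by ring.
    eapply Rle_trans; [apply Cmod_triangle|].
    rewrite Cmod_mult, Cmod_R; unfold M; nra. }
  assert (H4 : Cmod (g s - g t) < d).
  { eapply Rle_lt_trans; [apply H3|].
    apply Rmult_lt_compat_l with (r := M) in Hsd; auto.
    replace (M * (d / M)) with d in Hsd by (field; lra); exact Hsd. }
  specialize (Hd _ H4).
  replace (f (g s) - f (g t) - l * m * RtoC (s - t))%C with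
    ((f (g s) - f (g t) - l * (g s - g t)) + l * (g s - g t - m * RtoC (s - t)))%C by ring.
  eapply Rle_trans; [apply Cmod_triangle|].
  rewrite Cmod_mult.
  assert (H5 : Cmod l * Cmod (g s - g t - m * RtoC (s - t)) <= eps / 2 * Rabs (s - t)).
  { apply Rle_trans with (L * (eps / 2 / L * Rabs (s - t))).
    - apply Rmult_le_compat; auto using Cmod_ge_0; unfold L; lra.
    - right; field; lra. }
  assert (H6 : eps / 2 / M * Cmod (g s - g t) <= eps / 2 * Rabs (s - t)).
  { apply Rle_trans with (eps / 2 / M * (M * Rabs (s - t))).
    - apply Rmult_le_compat_l; auto; apply Rlt_le, Rdiv_lt_0_compat; lra.
    - right; field; lra. }
  lra.
Qed.

Lemma is_derive_C_continuous (f : C -> C) (z l : C) :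
  is_derive (K := C_AbsRing) (V := C_NormedModule) f z l ->
  continuous (T := C_UniformSpace) (U := C_UniformSpace) f z.
Proof.
  intros H P HP.
  assert (Hf : ex_derive (K := C_AbsRing) (V := C_NormedModule) f z) by (exists l; exact H).
  apply locally_C, (ex_derive_continuous (K := C_AbsRing) (V := C_NormedModule) f z Hf P HP).
Qed.

Lemma continuous_C_eps (f : C -> C) (z : C) :
  continuous (T := C_UniformSpace) (U := C_UniformSpace) f z <->
  forall eps, 0 < eps -> exists d, 0 < d /\ forall w, Cmod (w - z) < d -> Cmod (f w - f z) < eps.
Proof.
  split.
  - intros H eps He.
    assert (H0 : locally (T := C_UniformSpace) (f z) (fun y => Cmod (y - f z) < eps)).
    { apply locally_C_Cmod; exists eps; auto. }
    apply H, locally_C_Cmod in H0; exact H0.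
  - intros H P HP; apply locally_C_Cmod in HP; destruct HP as [e [e0 He]].
    apply locally_C_Cmod; destruct (H e e0) as [d [d0 Hd]]; exists d; split; auto.
Qed.

Lemma continuous_Re_Im {U : UniformSpace} (f : U -> C) (x : U) :
  continuous (U := C_UniformSpace) f x <->
  continuous (fun y => Re (f y)) x /\ continuous (fun y => Im (f y)) x.
Proof.
  split.
  - intros H; split.
    + apply (continuous_comp (V := C_UniformSpace) f (fun z : C => fst z)); auto.
      destruct (f x); apply continuous_fst.
    + apply (continuous_comp (V := C_UniformSpace) f (fun z : C => snd z)); auto.
      destruct (f x); apply continuous_snd.
  - intros [H1 H2]; apply (continuous_ext (U := C_UniformSpace) (fun y => (Re (f y), Im (f y)))).
    { intros y; destruct (f y); reflexivity. }
    apply filterlim_locally; intros eps.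
    apply (filter_and _ _ ((proj1 (filterlim_locally _ _)) H1 eps) ((proj1 (filterlim_locally _ _)) H2 eps)).
Qed.

Section ContinuousC.

Context {U : UniformSpace}.

Lemma continuous_Cplus (f g : U -> C) (x : U) :
  continuous (U := C_UniformSpace) f x -> continuous (U := C_UniformSpace) g x ->
  continuous (U := C_UniformSpace) (fun y => f y + g y)%C x.
Proof. apply (continuous_plus (V := C_R_NormedModule) f g). Qed.

Lemma continuous_Cminus (f g : U -> C) (x : U) :
  continuous (U := C_UniformSpace) f x -> continuous (U := C_UniformSpace) g x ->
  continuous (U := C_UniformSpace) (fun y => f y - g y)%C x.
Proof. apply (continuous_minus (V := C_R_NormedModule) f g). Qed.

Lemma continuous_Cmult (f g : U -> C) (x : U) :
  continuous (U := C_UniformSpace) f x -> continuous (U := C_UniformSpace) g x ->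
  continuous (U := C_UniformSpace) (fun y => f y * g y)%C x.
Proof.
  rewrite !continuous_Re_Im; intros [H1 H2] [H3 H4]; split.
  - apply (continuous_minus (V := R_NormedModule)); apply (continuous_mult (K := R_AbsRing)); assumption.
  - apply (continuous_plus (V := R_NormedModule)); apply (continuous_mult (K := R_AbsRing)); assumption.
Qed.

Lemma continuous_Cinv (f : U -> C) (x : U) :
  continuous (U := C_UniformSpace) f x -> f x <> RtoC 0 ->
  continuous (U := C_UniformSpace) (fun y => / f y)%C x.
Proof.
  rewrite !continuous_Re_Im; intros [H1 H2] H0.
  assert (Hd : continuous (fun y => / (Re (f y) ^ 2 + Im (f y) ^ 2)) x).
  { apply (continuous_comp (fun y => Re (f y) ^ 2 + Im (f y) ^ 2) Rinv).
    - apply (continuous_plus (V := R_NormedModule)); simpl;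
      repeat apply (continuous_mult (K := R_AbsRing)); auto using continuous_const.
    - apply continuous_Rinv. rewrite <- Cmod2_alt.
      apply pow_nonzero; intros H; apply H0, Cmod_eq_0, H. }
  split; apply (continuous_mult (K := R_AbsRing)); auto.
  apply (continuous_opp (V := R_NormedModule)); assumption.
Qed.

Lemma continuous_RtoC (u : U -> R) (x : U) :
  continuous u x -> continuous (U := C_UniformSpace) (fun y => RtoC (u y)) x.
Proof. intros H; apply continuous_Re_Im; split; simpl; [exact H|apply continuous_const]. Qed.

End ContinuousC.

(** * The complex exponential *)

Lemma Cexp_plus (z w : C) : Cexp (z + w) = (Cexp z * Cexp w)%C.
Proof.
  apply C_eq; unfold Cexp, Re, Im; simpl; rewrite exp_plus, ?cos_plus, ?sin_plus; ring.
Qed.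

Lemma Cexp_0 : Cexp 0 = RtoC 1.
Proof. apply C_eq; unfold Cexp, Re, Im; simpl; rewrite exp_0, ?cos_0, ?sin_0; ring. Qed.

Lemma Cmod_Cexp (z : C) : Cmod (Cexp z) = exp (Re z).
Proof.
  unfold Cexp, Cmod; simpl.
  replace (_ + _) with (Rsqr (exp (Re z))).
  - apply sqrt_Rsqr, Rlt_le, exp_pos.
  - pose proof (sin2_cos2 (Im z)); unfold Rsqr in *; nra.
Qed.

Lemma Cexp_neq_0 (z : C) : Cexp z <> RtoC 0.
Proof. intros H; apply (f_equal Cmod) in H; rewrite Cmod_Cexp, Cmod_0 in H; pose proof (exp_pos (Re z)); lra. Qed.

Lemma Cexp_opp (z : C) : Cexp (- z) = (/ Cexp z)%C.
Proof.
  assert (H : (Cexp (- z) * Cexp z)%C = RtoC 1).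
  { rewrite <- Cexp_plus, <- Cexp_0; f_equal; ring. }
  replace (Cexp (- z)) with (Cexp (- z) * Cexp z / Cexp z)%C by (field; apply Cexp_neq_0).
  rewrite H; field; apply Cexp_neq_0.
Qed.

Lemma is_derive_Cexp_R (g : R -> C) (t : R) (m : C) :
  is_derive (K := R_AbsRing) (V := C_R_NormedModule) g t m ->
  is_derive (K := R_AbsRing) (V := C_R_NormedModule) (fun s => Cexp (g s)) t (Cexp (g t) * m)%C.
Proof.
  rewrite !is_derive_Re_Im; intros [H1 H2].
  set (u := fun s => Re (g s)) in *; set (v := fun s => Im (g s)) in *.
  assert (D1 : Derive u t = Re m) by (apply is_derive_unique, H1).
  assert (D2 : Derive v t = Im m) by (apply is_derive_unique, H2).
  assert (E1 : ex_derive u t) by (eexists; eassumption).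
  assert (E2 : ex_derive v t) by (eexists; eassumption).
  assert (K : is_derive (fun s => exp (u s) * cos (v s)) t (Re (Cexp (g t) * m)) /\
    is_derive (fun s => exp (u s) * sin (v s)) t (Im (Cexp (g t) * m))); [|exact K].
  split; auto_derive; auto;
    change (Derive (fun s => u s) t) with (Derive u t);
    change (Derive (fun s => v s) t) with (Derive v t);
    rewrite D1, D2; unfold Re, Im, Cexp, u, v; simpl; ring.
Qed.

Lemma continuous_Cexp (z : C) : continuous (T := C_UniformSpace) (U := C_UniformSpace) Cexp z.
Proof.
  assert (H := continuous_id (U := C_UniformSpace) z).
  apply continuous_Re_Im in H; destruct H as [H1 H2].
  assert (H3 : continuous (T := C_UniformSpace) (U := R_UniformSpace) (fun w => exp (Re w)) z).
  { apply (continuous_comp (fun w : C_UniformSpace => Re w) exp); [exact H1|apply continuous_exp]. }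
  apply continuous_Re_Im; split; apply (continuous_mult (K := R_AbsRing)); auto;
    [apply (continuous_comp (fun w : C_UniformSpace => Im w) cos)|apply (continuous_comp (fun w : C_UniformSpace => Im w) sin)];
    auto using continuous_cos, continuous_sin.
Qed.

(** * Riemann integrals of complex-valued functions *)

Lemma is_RInt_Re_Im (f : R -> C) (a b : R) (l : C) :
  is_RInt (V := C_R_NormedModule) f a b l <->
  is_RInt (fun t => Re (f t)) a b (Re l) /\ is_RInt (fun t => Im (f t)) a b (Im l).
Proof.
  split.
  - intros H; split.
    + apply (is_RInt_fct_extend_fst (U := R_NormedModule) (V := R_NormedModule) f a b l H).
    + apply (is_RInt_fct_extend_snd (U := R_NormedModule) (V := R_NormedModule) f a b l H).
  - intros [H1 H2]; destruct l as [lu lv].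
    apply (is_RInt_fct_extend_pair (U := R_NormedModule) (V := R_NormedModule) f a b lu lv H1 H2).
Qed.

(** The codomain is a real normed module, so a complex factor is not one of its scalars; the
    integral is split into real and imaginary parts. *)
Lemma is_RInt_Cmult (c : C) (f : R -> C) (a b : R) (l : C) :
  is_RInt (V := C_R_NormedModule) f a b l ->
  is_RInt (V := C_R_NormedModule) (fun t => c * f t)%C a b (c * l)%C.
Proof.
  rewrite !is_RInt_Re_Im; intros [H1 H2]; split.
  - apply (is_RInt_minus (V := R_NormedModule) (fun t => Re c * Re (f t)) (fun t => Im c * Im (f t)));
      apply (is_RInt_scal (V := R_NormedModule)); assumption.
  - apply (is_RInt_plus (V := R_NormedModule) (fun t => Re c * Im (f t)) (fun t => Im c * Re (f t)));
      apply (is_RInt_scal (V := R_NormedModule)); assumption.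
Qed.

Lemma Cmod_RInt_le (f : R -> C) (a b M : R) (l : C) :
  a <= b -> (forall t, a <= t <= b -> Cmod (f t) <= M) ->
  is_RInt (V := C_R_NormedModule) f a b l -> Cmod l <= (b - a) * M.
Proof.
  intros Hab HM H; rewrite <- norm_C_R.
  apply (norm_RInt_le_const (V := C_R_NormedModule) f a b l M Hab); auto.
  intros t Ht; rewrite norm_C_R; auto.
Qed.

(** * Goursat's theorem on rectangles *)

(** The supremum of the left endpoints works: every [b m] bounds every [a n], as seen at the common
    index [n + m]. *)
Lemma nested_intervals (a b : nat -> R) :
  (forall n, a n <= a (S n)) -> (forall n, b (S n) <= b n) -> (forall n, a n <= b n) ->
  exists x, forall n, a n <= x <= b n.
Proof.
  intros Ha Hb Hab.
  assert (La : forall n k, a n <= a (n + k)%nat).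
  { intros n k; induction k; [rewrite Nat.add_0_r; lra|].
    rewrite Nat.add_succ_r; specialize (Ha (n + k)%nat); lra. }
  assert (Lb : forall n k, b (n + k)%nat <= b n).
  { intros n k; induction k; [rewrite Nat.add_0_r; lra|].
    rewrite Nat.add_succ_r; specialize (Hb (n + k)%nat); lra. }
  assert (H : forall n m, a n <= b m).
  { intros n m; pose proof (La n m); pose proof (Lb m n); pose proof (Hab (n + m)%nat).
    rewrite (Nat.add_comm m n) in *; lra. }
  destruct (completeness (fun y => exists n, y = a n)) as [x [Hx1 Hx2]].
  - exists (b 0%nat); intros y [n ->]; apply H.
  - exists (a 0%nat), 0%nat; reflexivity.
  - exists x; intros n; split; [apply Hx1; exists n; reflexivity|].
    apply Hx2; intros y [m ->]; apply H.
Qed.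

Lemma half_pow_small (w d : R) : 0 < d -> exists n, w * (1 / 2) ^ n < d.
Proof.
  intros Hd.
  destruct (pow_lt_1_zero (1 / 2) ltac:(rewrite Rabs_pos_eq; lra) (d / (Rabs w + 1))) as [N HN].
  { apply Rdiv_lt_0_compat; pose proof (Rabs_pos w); lra. }
  exists N; specialize (HN N (le_n _)).
  pose proof (Rabs_pos w).
  assert (Hp : 0 < (1 / 2) ^ N) by (apply pow_lt; lra).
  rewrite Rabs_pos_eq in HN by lra.
  apply Rmult_lt_compat_l with (r := Rabs w + 1) in HN; [|lra].
  replace ((Rabs w + 1) * (d / (Rabs w + 1))) with d in HN by (field; lra).
  pose proof (Rle_abs w); nra.
Qed.

(** Bisection as an induction principle. A rectangle where [P] fails has a quarter where it fails;
    iterating gives nested bad rectangles that shrink to a point, and near that point the local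
    hypothesis forces [P]. *)
Lemma rect_induction (P : R -> R -> R -> R -> Prop) (a b c d : R) :
  a <= b -> c <= d ->
  (forall a b c d, a <= b -> c <= d ->
    P a ((a + b) / 2) c ((c + d) / 2) -> P ((a + b) / 2) b c ((c + d) / 2) ->
    P a ((a + b) / 2) ((c + d) / 2) d -> P ((a + b) / 2) b ((c + d) / 2) d ->
    P a b c d) ->
  (forall x y, a <= x <= b -> c <= y <= d -> exists e, 0 < e /\
    forall a' b' c' d', a' <= x <= b' -> c' <= y <= d' -> b' - a' < e -> d' - c' < e ->
      P a' b' c' d') ->
  P a b c d.
Proof.
  intros Hab Hcd Hsub Hloc; apply NNPP; intros Hbad.
  (* The inequalities between endpoints are part of badness, so that they survive the iteration and
     [Hsub] stays applicable. *)
  set (bad := fun q : (R * R) * (R * R) =>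
    fst (fst q) <= snd (fst q) /\ fst (snd q) <= snd (snd q) /\
    ~ P (fst (fst q)) (snd (fst q)) (fst (snd q)) (snd (snd q))).
  set (half := fun u v : R * R => fst u <= fst v /\ snd v <= snd u /\ snd v - fst v = (snd u - fst u) / 2).
  assert (step : forall s : {q | bad q}, exists s' : {q | bad q},
    half (fst (proj1_sig s)) (fst (proj1_sig s')) /\ half (snd (proj1_sig s)) (snd (proj1_sig s'))).
  { intros [[[a1 b1] [c1 d1]] [H1 [H2 H3]]]; simpl in *.
    apply NNPP; intros HN; apply H3.
    assert (G : forall a2 b2 c2 d2, a1 <= a2 -> b2 <= b1 -> b2 - a2 = (b1 - a1) / 2 ->
      c1 <= c2 -> d2 <= d1 -> d2 - c2 = (d1 - c1) / 2 -> P a2 b2 c2 d2).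
    { intros a2 b2 c2 d2 E1 E2 E3 E4 E5 E6; apply NNPP; intros HP; apply HN.
      assert (B : bad ((a2, b2), (c2, d2))) by (unfold bad; simpl; repeat split; auto; lra).
      exists (exist _ _ B); unfold half; simpl; auto 10. }
    apply Hsub; try lra; apply G; lra. }
  (* A choice function on bad rectangles turns the nested sequence into plain iteration. *)
  set (next := fun s => proj1_sig (constructive_indefinite_description _ (step s))).
  assert (Hnext : forall s, half (fst (proj1_sig s)) (fst (proj1_sig (next s))) /\
    half (snd (proj1_sig s)) (snd (proj1_sig (next s)))).
  { intros s; unfold next; apply (proj2_sig (constructive_indefinite_description _ (step s))). }
  assert (B0 : bad ((a, b), (c, d))) by (unfold bad; simpl; auto).
  set (q := fun n => Nat.iter n next (exist bad _ B0)).
  set (an := fun n => fst (fst (proj1_sig (q n)))); set (bn := fun n => snd (fst (proj1_sig (q n)))).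
  set (cn := fun n => fst (snd (proj1_sig (q n)))); set (dn := fun n => snd (snd (proj1_sig (q n)))).
  assert (Hq : forall n, (an n <= an (S n) /\ bn (S n) <= bn n /\ bn (S n) - an (S n) = (bn n - an n) / 2) /\
    (cn n <= cn (S n) /\ dn (S n) <= dn n /\ dn (S n) - cn (S n) = (dn n - cn n) / 2)).
  { intros n; apply (Hnext (q n)). }
  assert (Hn : forall n, an n <= bn n /\ cn n <= dn n /\ ~ P (an n) (bn n) (cn n) (dn n)).
  { intros n; apply (proj2_sig (q n)). }
  destruct (nested_intervals an bn) as [x Hx]; try apply Hq; try apply Hn.
  destruct (nested_intervals cn dn) as [y Hy]; try apply Hq; try apply Hn.
  assert (W : forall n, bn n - an n = (b - a) * (1 / 2) ^ n /\ dn n - cn n = (d - c) * (1 / 2) ^ n).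
  { induction n as [|n [I1 I2]].
    - unfold an, bn, cn, dn; simpl; lra.
    - destruct (Hq n) as [[_ [_ E1]] [_ [_ E2]]]; rewrite E1, E2, I1, I2; simpl; lra. }
  destruct (Hloc x y (Hx 0%nat) (Hy 0%nat)) as [e [e0 He]].
  (* The longer side decides; the same [n] then serves both directions. *)
  destruct (half_pow_small (Rmax (b - a) (d - c)) e e0) as [n Hn'].
  assert (Hp : 0 < (1 / 2) ^ n) by (apply pow_lt; lra).
  pose proof (Rmax_l (b - a) (d - c)); pose proof (Rmax_r (b - a) (d - c)).
  destruct (W n) as [W1 W2].
  apply (Hn n), He; auto; [rewrite W1|rewrite W2]; nra.
Qed.

(** * Integrals around rectangles *)

Definition RI (f : R -> C) (a b : R) : C := RInt (V := C_R_CompleteNormedModule) f a b.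

Lemma is_RInt_RI (f : R -> C) (a b : R) :
  (forall t, Rmin a b <= t <= Rmax a b -> continuous (U := C_UniformSpace) f t) ->
  is_RInt (V := C_R_NormedModule) f a b (RI f a b).
Proof.
  intros H; apply (RInt_correct (V := C_R_CompleteNormedModule)).
  apply (ex_RInt_continuous (V := C_R_CompleteNormedModule)); exact H.
Qed.

Lemma RI_unique (f : R -> C) (a b : R) (l : C) :
  is_RInt (V := C_R_NormedModule) f a b l -> RI f a b = l.
Proof. apply (is_RInt_unique (V := C_R_CompleteNormedModule)). Qed.

Local Notation ccont g := (forall z : C, continuous (T := C_UniformSpace) (U := C_UniformSpace) g z).

Lemma continuous_horizontal (g : C -> C) (y t : R) :
  continuous (T := C_UniformSpace) (U := C_UniformSpace) g (t, y) ->
  continuous (U := C_UniformSpace) (fun t => g (t, y)) t.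
Proof.
  intros Hg; apply (continuous_comp (V := C_UniformSpace) (W := C_UniformSpace) (fun t : R => (t, y))); [|exact Hg].
  apply continuous_Re_Im; split; [apply (continuous_id (U := R_UniformSpace))|apply continuous_const].
Qed.

Lemma continuous_vertical (g : C -> C) (x t : R) :
  continuous (T := C_UniformSpace) (U := C_UniformSpace) g (x, t) ->
  continuous (U := C_UniformSpace) (fun t => g (x, t)) t.
Proof.
  intros Hg; apply (continuous_comp (V := C_UniformSpace) (W := C_UniformSpace) (fun t : R => (x, t))); [|exact Hg].
  apply continuous_Re_Im; split; [apply continuous_const|apply (continuous_id (U := R_UniformSpace))].
Qed.

(** Counterclockwise boundary integral: bottom, right, top, left. On the vertical sides [dz = i dt],
    which accounts for [Ci]. *)
Definition rect_int (g : C -> C) (a b c d : R) : C :=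
  (RI (fun t => g (t, c)) a b + Ci * RI (fun t => g (b, t)) c d
   - RI (fun t => g (t, d)) a b - Ci * RI (fun t => g (a, t)) c d)%C.

Lemma RI_Chasles (f : R -> C) (a b c : R) :
  (forall t, continuous (U := C_UniformSpace) f t) -> RI f a c = (RI f a b + RI f b c)%C.
Proof.
  intros H; apply RI_unique, (is_RInt_Chasles (V := C_R_NormedModule) f a b c); apply is_RInt_RI; auto.
Qed.

Lemma rect_int_split_x (g : C -> C) (a m b c d : R) : ccont g ->
  rect_int g a b c d = (rect_int g a m c d + rect_int g m b c d)%C.
Proof.
  intros Hg; unfold rect_int.
  rewrite (RI_Chasles (fun t => g (t, c)) a m b), (RI_Chasles (fun t => g (t, d)) a m b);
    try (intros; apply continuous_horizontal, Hg).
  ring.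
Qed.

Lemma rect_int_split_y (g : C -> C) (a b c m d : R) : ccont g ->
  rect_int g a b c d = (rect_int g a b c m + rect_int g a b m d)%C.
Proof.
  intros Hg; unfold rect_int.
  rewrite (RI_Chasles (fun t => g (a, t)) c m d), (RI_Chasles (fun t => g (b, t)) c m d);
    try (intros; apply continuous_vertical, Hg).
  ring.
Qed.

Lemma RI_minus (f g : R -> C) (a b : R) :
  (forall t, continuous (U := C_UniformSpace) f t) -> (forall t, continuous (U := C_UniformSpace) g t) ->
  RI (fun t => f t - g t)%C a b = (RI f a b - RI g a b)%C.
Proof.
  intros Hf Hg; apply RI_unique, (is_RInt_minus (V := C_R_NormedModule) f g); apply is_RInt_RI; auto.
Qed.

Lemma rect_int_minus (g h : C -> C) (a b c d : R) : ccont g -> ccont h ->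
  rect_int (fun z => g z - h z)%C a b c d = (rect_int g a b c d - rect_int h a b c d)%C.
Proof.
  intros Hg Hh; unfold rect_int; rewrite !RI_minus; try ring;
    intros; apply continuous_horizontal || apply continuous_vertical; auto.
Qed.

Lemma Cmod_rect_int_le (g : C -> C) (a b c d M : R) : ccont g -> a <= b -> c <= d ->
  (forall x y, a <= x <= b -> c <= y <= d -> Cmod (g (x, y)) <= M) ->
  Cmod (rect_int g a b c d) <= 2 * ((b - a) + (d - c)) * M.
Proof.
  intros Hg Hab Hcd HM; unfold rect_int.
  assert (H1 : forall y, c <= y <= d -> Cmod (RI (fun t => g (t, y)) a b) <= (b - a) * M).
  { intros y Hy; apply Cmod_RInt_le with (fun t => g (t, y)); auto.
    apply is_RInt_RI; intros; apply continuous_horizontal, Hg. }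
  assert (H2 : forall x, a <= x <= b -> Cmod (RI (fun t => g (x, t)) c d) <= (d - c) * M).
  { intros x Hx; apply Cmod_RInt_le with (fun t => g (x, t)); auto.
    apply is_RInt_RI; intros; apply continuous_vertical, Hg. }
  pose proof (H1 c ltac:(lra)); pose proof (H1 d ltac:(lra)).
  pose proof (H2 a ltac:(lra)); pose proof (H2 b ltac:(lra)).
  unfold Cminus.
  eapply Rle_trans; [apply Cmod_triangle|].
  eapply Rle_trans; [apply Rplus_le_compat_r, Cmod_triangle|].
  eapply Rle_trans; [apply Rplus_le_compat_r, Rplus_le_compat_r, Cmod_triangle|].
  rewrite !Cmod_opp, !Cmod_mult, !Cmod_Ci; lra.
Qed.

(** The fundamental theorem turns each side into a difference of corner values of [G], and these
    cancel around the boundary. *)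
Lemma rect_int_primitive (g G : C -> C) (a b c d : R) : ccont g ->
  (forall z, is_derive (K := C_AbsRing) (V := C_NormedModule) G z (g z)) ->
  rect_int g a b c d = RtoC 0.
Proof.
  intros Hg HG; unfold rect_int.
  assert (H1 : forall y, RI (fun t => g (t, y)) a b = (G (b, y) - G (a, y))%C).
  { intros y; apply RI_unique.
    apply (is_RInt_derive (V := C_R_CompleteNormedModule) (fun t => G (t, y))).
    - intros t _; replace (g (t, y)) with (g (t, y) * RtoC 1)%C by ring.
      apply (is_derive_C_comp_R G (fun t => (t, y))); [apply HG|].
      apply is_derive_Re_Im; split; simpl;
        [apply (is_derive_id (K := R_AbsRing))|apply (is_derive_const (K := R_AbsRing) (V := R_NormedModule))].
    - intros t _; apply continuous_horizontal, Hg. }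
  assert (H2 : forall x, (Ci * RI (fun t => g (x, t)) c d = G (x, d) - G (x, c))%C).
  { intros x; rewrite <- (RI_unique (fun t => Ci * g (x, t))%C c d (Ci * RI (fun t => g (x, t)) c d)%C).
    2:{ apply is_RInt_Cmult, is_RInt_RI; intros; apply continuous_vertical, Hg. }
    apply RI_unique.
    apply (is_RInt_derive (V := C_R_CompleteNormedModule) (fun t => G (x, t))).
    - intros t _; rewrite Cmult_comm.
      apply (is_derive_C_comp_R G (fun t => (x, t))); [apply HG|].
      apply is_derive_Re_Im; split; simpl;
        [apply (is_derive_const (K := R_AbsRing) (V := R_NormedModule))|apply (is_derive_id (K := R_AbsRing))].
    - intros t _; apply (continuous_Cmult (fun _ => Ci) (fun t => g (x, t))); [apply continuous_const|].
      apply continuous_vertical, Hg. }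
  rewrite !H1, !H2; ring.
Qed.

(** The remainder is exactly [q / 2 * (w - z) ^ 2]. This supplies a primitive for the affine part
    that is subtracted in Goursat's theorem. *)
Lemma is_derive_quadratic (p q z : C) :
  is_derive (K := C_AbsRing) (V := C_NormedModule) (fun z => p * z + q / 2 * (z * z))%C z (p + q * z)%C.
Proof.
  apply is_derive_C_eps; intros eps He.
  set (Q := Cmod (q / 2) + 1).
  assert (HQ : 0 < Q) by (unfold Q; pose proof (Cmod_ge_0 (q / 2)); lra).
  exists (eps / Q); split; [apply Rdiv_lt_0_compat; lra|]; intros w Hw.
  replace (p * w + q / 2 * (w * w) - (p * z + q / 2 * (z * z)) - (p + q * z) * (w - z))%C
    with (q / 2 * (w - z) * (w - z))%C by field.
  rewrite !Cmod_mult; apply Rmult_le_compat_r; [apply Cmod_ge_0|].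
  apply Rle_trans with (Q * (eps / Q)); [|right; field; lra].
  apply Rmult_le_compat; try apply Cmod_ge_0; [unfold Q; lra|lra].
Qed.

Lemma rect_int_affine (p q : C) (a b c d : R) : rect_int (fun z => p + q * z)%C a b c d = RtoC 0.
Proof.
  apply rect_int_primitive with (fun z => p * z + q / 2 * (z * z))%C.
  - intros z; apply continuous_Cplus; [apply continuous_const|].
    apply continuous_Cmult; [apply continuous_const|apply continuous_id].
  - apply is_derive_quadratic.
Qed.

Lemma Cmod_eps_0 (z : C) (K : R) : (forall eps, 0 < eps -> Cmod z <= eps * K) -> z = RtoC 0.
Proof.
  intros H; apply Cmod_eq_0, Rle_antisym; [|apply Cmod_ge_0].
  apply le_epsilon; intros e He; rewrite Rplus_0_l.
  pose proof (Rabs_pos K); pose proof (Rle_abs K).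
  specialize (H (e / (Rabs K + 1)) ltac:(apply Rdiv_lt_0_compat; lra)).
  eapply Rle_trans; [apply H|].
  assert (0 < e / (Rabs K + 1)) by (apply Rdiv_lt_0_compat; lra).
  apply Rle_trans with (e / (Rabs K + 1) * (Rabs K + 1)); [apply Rmult_le_compat_l; lra|].
  right; field; lra.
Qed.

(** The bound [eps * (2 * ((b - a) + (d - c)) ^ 2)] is exactly additive under quartering, since
    half-perimeters halve; bisection thus reduces it to small rectangles around one point. There [g]
    minus its tangent is at most [eps] times the half-perimeter, the tangent integrates to 0, and
    the boundary has twice the half-perimeter as length. *)
Theorem goursat (g : C -> C) (a b c d : R) : ccont g -> a <= b -> c <= d ->
  (forall x y, a <= x <= b -> c <= y <= d -> ex_derive (K := C_AbsRing) (V := C_NormedModule) g (x, y)) ->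
  rect_int g a b c d = RtoC 0.
Proof.
  intros Hg Hab Hcd Hd.
  apply Cmod_eps_0 with (2 * ((b - a) + (d - c)) ^ 2); intros eps He.
  apply (rect_induction (fun a b c d => Cmod (rect_int g a b c d) <= eps * (2 * ((b - a) + (d - c)) ^ 2))); auto.
  - clear a b c d Hab Hcd Hd; intros a b c d Hab Hcd H1 H2 H3 H4.
    rewrite (rect_int_split_x g a ((a + b) / 2) b c d Hg).
    rewrite (rect_int_split_y g _ _ c ((c + d) / 2) d Hg), (rect_int_split_y g ((a + b) / 2) _ c ((c + d) / 2) d Hg).
    eapply Rle_trans; [apply Cmod_triangle|].
    eapply Rle_trans; [apply Rplus_le_compat; apply Cmod_triangle|].
    eapply Rle_trans; [apply Rplus_le_compat; apply Rplus_le_compat; eassumption|].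
    right; field.
  - intros x y Hx Hy; destruct (Hd x y Hx Hy) as [l Hl].
    destruct (proj1 (is_derive_C_eps g (x, y) l) Hl eps He) as [e [e0 Hel]].
    (* Two sides shorter than [e / 2] keep every point of the rectangle within [e] of [(x, y)]. The
       constant [p] makes [p + l * z] the tangent at [(x, y)]. *)
    exists (e / 2); split; [lra|]; intros a' b' c' d' Hx' Hy' E1 E2.
    set (p := (g (x, y) - l * (x, y))%C).
    replace (rect_int g a' b' c' d') with (rect_int (fun z => g z - (p + l * z))%C a' b' c' d').
    2:{ rewrite rect_int_minus, rect_int_affine; [ring|exact Hg|].
        intros z; apply continuous_Cplus; [apply continuous_const|].
        apply continuous_Cmult; [apply continuous_const|apply continuous_id]. }
    replace (eps * (2 * (b' - a' + (d' - c')) ^ 2)) with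
      (2 * ((b' - a') + (d' - c')) * (eps * ((b' - a') + (d' - c')))) by ring.
    apply Cmod_rect_int_le; try lra.
    + intros z; apply continuous_Cminus; [apply Hg|].
      apply continuous_Cplus; [apply continuous_const|].
      apply continuous_Cmult; [apply continuous_const|apply continuous_id].
    + intros u v Hu Hv.
      assert (Hd' : Cmod ((u, v) - (x, y)) <= (b' - a') + (d' - c')).
      { eapply Rle_trans; [apply Cmod_le_Re_Im|]; simpl.
        apply Rplus_le_compat; apply Rabs_le; lra. }
      replace (g (u, v) - (p + l * (u, v)))%C with (g (u, v) - g (x, y) - l * ((u, v) - (x, y)))%C
        by (unfold p; ring).
      eapply Rle_trans; [apply Hel; lra|].
      apply Rmult_le_compat_l; lra.
Qed.

(* The exceptional point is enclosed in an arbitrarily small square; Goursat disposes of the rest. *)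
Theorem goursat_except (g : C -> C) (a b c d u v : R) : ccont g -> a < u < b -> c < v < d ->
  (forall z, z <> (u, v) -> ex_derive (K := C_AbsRing) (V := C_NormedModule) g z) ->
  rect_int g a b c d = RtoC 0.
Proof.
  intros Hg Hu Hv Hd.
  destruct (proj1 (continuous_C_eps g (u, v)) (Hg (u, v)) 1 ltac:(lra)) as [r [r0 Hr]].
  (* The enclosing square has side [2 * e], hence perimeter [8 * e], and by continuity [|g|] is at
     most [|g (u, v)| + 1] on it. *)
  apply Cmod_eps_0 with (8 * (Cmod (g (u, v)) + 1)); intros eps0 He0.
  (* With [r / 3] the square lies within [r] of the exceptional point; the last four entries keep it
     inside the rectangle. *)
  set (e1 := Rmin (Rmin eps0 (r / 3)) (Rmin (Rmin (u - a) (b - u)) (Rmin (v - c) (d - v)))).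
  assert (He : exists e, 0 < e /\ e <= eps0 /\ e < r / 2 /\ e <= u - a /\ e <= b - u /\ e <= v - c /\ e <= d - v).
  { exists e1; unfold e1.
    pose proof (Rmin_l (Rmin eps0 (r / 3)) (Rmin (Rmin (u - a) (b - u)) (Rmin (v - c) (d - v)))).
    pose proof (Rmin_r (Rmin eps0 (r / 3)) (Rmin (Rmin (u - a) (b - u)) (Rmin (v - c) (d - v)))).
    pose proof (Rmin_l eps0 (r / 3)); pose proof (Rmin_r eps0 (r / 3)).
    pose proof (Rmin_l (Rmin (u - a) (b - u)) (Rmin (v - c) (d - v))).
    pose proof (Rmin_r (Rmin (u - a) (b - u)) (Rmin (v - c) (d - v))).
    pose proof (Rmin_l (u - a) (b - u)); pose proof (Rmin_r (u - a) (b - u)).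
    pose proof (Rmin_l (v - c) (d - v)); pose proof (Rmin_r (v - c) (d - v)).
    split; [repeat apply Rmin_pos; lra|]; lra. }
  clear e1; destruct He as [e [e0 [E1 [E2 [E3 [E4 [E5 E6]]]]]]].
  rewrite (rect_int_split_x g a (u - e) b c d Hg), (rect_int_split_x g (u - e) (u + e) b c d Hg).
  rewrite (rect_int_split_y g (u - e) (u + e) c (v - e) d Hg), (rect_int_split_y g (u - e) (u + e) (v - e) (v + e) d Hg).
  rewrite (goursat g a (u - e) c d), (goursat g (u + e) b c d), (goursat g (u - e) (u + e) c (v - e)),
    (goursat g (u - e) (u + e) (v + e) d); try exact Hg; try lra;
    try (intros x y Hx Hy; apply Hd; intros E; inversion E; lra).
  replace (0 + (0 + (rect_int g (u - e) (u + e) (v - e) (v + e) + 0) + 0))%C with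
    (rect_int g (u - e) (u + e) (v - e) (v + e)) by ring.
  eapply Rle_trans.
  - apply Cmod_rect_int_le with (M := Cmod (g (u, v)) + 1); try exact Hg; try lra.
    intros x y Hx Hy.
    replace (g (x, y)) with ((g (x, y) - g (u, v)) + g (u, v))%C by ring.
    eapply Rle_trans; [apply Cmod_triangle|].
    assert (Cmod (g (x, y) - g (u, v)) < 1); [|lra].
    apply Hr; eapply Rle_lt_trans; [apply Cmod_le_Re_Im|]; simpl.
    assert (Rabs (x + - u) <= e) by (apply Rabs_le; lra).
    assert (Rabs (y + - v) <= e) by (apply Rabs_le; lra).
    lra.
  - pose proof (Cmod_ge_0 (g (u, v))); nra.
Qed.

(** * Continuity of the derivative of an entire function *)

Local Notation is_Cderive := (is_derive (K := C_AbsRing) (V := C_NormedModule)).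

Lemma is_derive_C_ext_loc (f g : C -> C) (z l : C) (d : R) :
  0 < d -> (forall w, Cmod (w - z) < d -> f w = g w) -> is_Cderive f z l -> is_Cderive g z l.
Proof.
  intros d0 H; apply is_derive_ext_loc, locally_C, locally_C_Cmod; exists d; auto.
Qed.

(** The remainder conditions of the two module structures agree by conversion, so only the linearity
    component is rebuilt. This makes the general product rule [is_derive_mult] applicable. *)
Lemma is_derive_C_AbsRing (f : C -> C) (z l : C) :
  is_Cderive f z l <-> is_derive (K := C_AbsRing) (V := AbsRing_NormedModule C_AbsRing) f z l.
Proof. split; intros [_ H]; (split; [apply is_linear_scal_l|exact H]). Qed.

Lemma is_derive_C_mult (f g : C -> C) (z df dg : C) :
  is_Cderive f z df -> is_Cderive g z dg ->
  is_Cderive (fun w => f w * g w)%C z (df * g z + f z * dg)%C.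
Proof.
  rewrite !is_derive_C_AbsRing; intros Hf Hg.
  apply (is_derive_mult (K := C_AbsRing) f g z df dg Hf Hg); intros; apply Cmult_comm.
Qed.

Lemma is_derive_C_cmult (c : C) (f : C -> C) (z df : C) :
  is_Cderive f z df -> is_Cderive (fun w => c * f w)%C z (c * df)%C.
Proof.
  intros H; replace (c * df)%C with (0 * f z + c * df)%C by ring.
  apply (is_derive_C_mult (fun _ => c) f); [|exact H].
  apply (is_derive_const (K := C_AbsRing) (V := C_NormedModule)).
Qed.

Lemma is_derive_C_translate (f : C -> C) (p z l : C) :
  is_Cderive f (p + z)%C l <-> is_Cderive (fun w => f (p + w))%C z l.
Proof.
  rewrite !is_derive_C_eps; split; intros H eps He; destruct (H eps He) as [d [d0 Hd]];
    exists d; split; auto; intros w Hw.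
  - specialize (Hd (p + w)%C); replace (p + w - (p + z))%C with (w - z)%C in Hd by ring; auto.
  - specialize (Hd (w - p)%C).
    replace (w - p - z)%C with (w - (p + z))%C in Hd by ring.
    replace (p + (w - p))%C with w in Hd by ring; auto.
Qed.

Lemma Cmod_sub_ge (z w p : C) : Cmod (z - p) - Cmod (w - p) <= Cmod (z - w).
Proof.
  pose proof (Cmod_triangle (z - w) (w - p)).
  replace (z - w + (w - p))%C with (z - p)%C in H by ring; lra.
Qed.

Lemma Cmod_pos_neq_0 (z : C) : 0 < Cmod z -> z <> RtoC 0.
Proof. intros H E; rewrite E, Cmod_0 in H; lra. Qed.

(** * Cauchy-type integrals along a path, differentiated under the integral sign *)

Section CauchyKernel.

Context (phi gam : R -> C) (a b r : R) (z0 : C).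
Hypothesis Hab : a <= b.
Hypothesis Hr : 0 < r.
Hypothesis Hphi : forall t, continuous (U := C_UniformSpace) phi t.
Hypothesis Hgam : forall t, continuous (U := C_UniformSpace) gam t.
Hypothesis Hdist : forall t, a <= t <= b -> 2 * r <= Cmod (gam t - z0).

(** Cauchy integral of the density [phi] and its formal derivative in [w]. The tangent of [gam] is
    left out: it is constant on each side of the square and is put in front later. The distance
    [2 * r] in [Hdist] keeps [gam] at least [r] away from every [w] in the disc of radius [r], so
    all inverses are at most [/ r]. *)
Definition kernel1 (w : C) : C := RI (fun t => phi t * / (gam t - w))%C a b.
Definition kernel2 (w : C) : C := RI (fun t => phi t * / (gam t - w) * / (gam t - w))%C a b.

Lemma kernel_dist (t : R) (w : C) : a <= t <= b -> Cmod (w - z0) < r -> r <= Cmod (gam t - w).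
Proof. intros Ht Hw; pose proof (Cmod_sub_ge (gam t) w z0); specialize (Hdist t Ht); lra. Qed.

Lemma kernel_neq_0 (t : R) (w : C) : a <= t <= b -> Cmod (w - z0) < r -> (gam t - w)%C <> RtoC 0.
Proof. intros Ht Hw; apply Cmod_pos_neq_0; pose proof (kernel_dist t w Ht Hw); lra. Qed.

Lemma kernel_inv (t : R) (w : C) : a <= t <= b -> Cmod (w - z0) < r -> Cmod (/ (gam t - w)) <= / r.
Proof.
  intros Ht Hw; rewrite Cmod_inv by (apply kernel_neq_0; auto).
  apply Rinv_le_contravar; auto; apply kernel_dist; auto.
Qed.

Lemma continuous_kernel (t : R) (w : C) : a <= t <= b -> Cmod (w - z0) < r ->
  continuous (U := C_UniformSpace) (fun t => / (gam t - w))%C t.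
Proof.
  intros Ht Hw; apply continuous_Cinv; [|apply kernel_neq_0; auto].
  apply continuous_Cminus; [apply Hgam|apply continuous_const].
Qed.

Lemma is_RInt_kernel1 (w : C) : Cmod (w - z0) < r ->
  is_RInt (V := C_R_NormedModule) (fun t => phi t * / (gam t - w))%C a b (kernel1 w).
Proof.
  intros Hw; apply is_RInt_RI; rewrite Rmin_left, Rmax_right by auto; intros t Ht.
  apply continuous_Cmult; [apply Hphi|apply continuous_kernel; auto].
Qed.

Lemma is_RInt_kernel2 (w : C) : Cmod (w - z0) < r ->
  is_RInt (V := C_R_NormedModule) (fun t => phi t * / (gam t - w) * / (gam t - w))%C a b (kernel2 w).
Proof.
  intros Hw; apply is_RInt_RI; rewrite Rmin_left, Rmax_right by auto; intros t Ht.
  apply continuous_Cmult; [|apply continuous_kernel; auto].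
  apply continuous_Cmult; [apply Hphi|apply continuous_kernel; auto].
Qed.

Lemma phi_bounded : exists M, 0 < M /\ forall t, a <= t <= b -> Cmod (phi t) <= M.
Proof.
  destruct (bounded_continuity (K := R_AbsRing) (V := C_R_NormedModule) phi a b) as [M HM].
  { intros t _; apply Hphi. }
  exists (Rabs M + 1); split; [pose proof (Rabs_pos M); lra|].
  intros t Ht; specialize (HM t Ht); rewrite norm_C_R in HM; pose proof (Rle_abs M); lra.
Qed.

Lemma Cmod_mult4_le (z1 z2 z3 z4 : C) (M s : R) : 0 < M -> 0 < s ->
  Cmod z1 <= M -> Cmod z2 <= s -> Cmod z3 <= s -> Cmod z4 <= s ->
  Cmod (z1 * z2 * z3 * z4) <= M * s * s * s.
Proof.
  intros; rewrite !Cmod_mult.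
  repeat (apply Rmult_le_compat; auto using Cmod_ge_0; repeat apply Rmult_le_pos; auto using Cmod_ge_0).
Qed.

(** With [h = w' - w] the remainder is exactly [h ^ 2] times the integral of
    [phi / ((gam - w) ^ 2 (gam - w'))], whose integrand is at most [M / r ^ 3]; a uniform bound thus
    replaces a limit theorem. *)
Lemma is_derive_kernel1 (w : C) : Cmod (w - z0) < r -> is_Cderive kernel1 w (kernel2 w).
Proof.
  intros Hw; destruct phi_bounded as [M [M0 HM]].
  apply is_derive_C_eps; intros eps He.
  set (B := (b - a) * (M * / r * / r * / r)).
  assert (Hir : 0 < / r) by (apply Rinv_0_lt_compat; auto).
  assert (HB : 0 <= B).
  { unfold B; repeat apply Rmult_le_pos; lra. }
  (* The first entry keeps [w'] in the disc, the second makes [B * |h|] at most [eps]; the 1 in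
     [B + 1] avoids a division by 0. *)
  exists (Rmin (r - Cmod (w - z0)) (eps / (B + 1))); split.
  { apply Rmin_pos; [lra|apply Rdiv_lt_0_compat; lra]. }
  intros w' Hw'.
  assert (H1 := Rlt_le_trans _ _ _ Hw' (Rmin_l _ _)).
  assert (H2 := Rlt_le_trans _ _ _ Hw' (Rmin_r _ _)).
  assert (Hw'0 : Cmod (w' - z0) < r).
  { replace (w' - z0)%C with ((w' - w) + (w - z0))%C by ring.
    eapply Rle_lt_trans; [apply Cmod_triangle|lra]. }
  set (h := (w' - w)%C) in *.
  assert (HI : is_RInt (V := C_R_NormedModule)
    (fun t => h * h * (phi t * / (gam t - w) * / (gam t - w) * / (gam t - w')))%C a b
    (kernel1 w' - kernel1 w - kernel2 w * h)%C).
  { apply is_RInt_ext with (fun t => (phi t * / (gam t - w') - phi t * / (gam t - w)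
        - h * (phi t * / (gam t - w) * / (gam t - w)))%C).
    - rewrite Rmin_left, Rmax_right by auto; intros t Ht; unfold h.
      match goal with |- ?l = ?r => change (@eq C l r) end.
      field; split; apply kernel_neq_0; auto; lra.
    - rewrite (Cmult_comm (kernel2 w) h).
      apply (is_RInt_minus (V := C_R_NormedModule)); [|apply is_RInt_Cmult, is_RInt_kernel2; auto].
      apply (is_RInt_minus (V := C_R_NormedModule)); apply is_RInt_kernel1; auto. }
  apply (Cmod_RInt_le _ a b (Cmod h * Cmod h * (M * / r * / r * / r))) in HI; auto.
  2:{ intros t Ht; rewrite !(Cmod_mult (h * h)), (Cmod_mult h).
      apply Rmult_le_compat_l; [apply Rmult_le_pos; apply Cmod_ge_0|].
      apply Cmod_mult4_le; auto using kernel_inv. }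
  eapply Rle_trans; [apply HI|].
  replace ((b - a) * (Cmod h * Cmod h * (M * / r * / r * / r))) with (B * Cmod h * Cmod h) by (unfold B; ring).
  apply Rmult_le_compat_r; [apply Cmod_ge_0|].
  apply Rle_trans with ((B + 1) * (eps / (B + 1))); [|right; field; lra].
  apply Rmult_le_compat; auto using Cmod_ge_0; lra.
Qed.

(** The difference of the inverse squares has the factor [h = w - z0], and the cofactor is a sum of
    two products of three bounded inverses. *)
Lemma continuous_kernel2 : continuous (T := C_UniformSpace) (U := C_UniformSpace) kernel2 z0.
Proof.
  destruct phi_bounded as [M [M0 HM]].
  apply continuous_C_eps; intros eps He.
  set (B := (b - a) * (M * / r * / r * / r + M * / r * / r * / r)).
  assert (Hir : 0 < / r) by (apply Rinv_0_lt_compat; auto).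
  assert (HB : 0 <= B).
  { unfold B; apply Rmult_le_pos; [lra|]; apply Rplus_le_le_0_compat; repeat apply Rmult_le_pos; lra. }
  assert (Hz0 : Cmod (z0 - z0) < r) by (unfold Cminus; rewrite Cplus_opp_r, Cmod_0; auto).
  exists (Rmin r (eps / (B + 1))); split.
  { apply Rmin_pos; [lra|apply Rdiv_lt_0_compat; lra]. }
  intros w Hw.
  assert (H1 := Rlt_le_trans _ _ _ Hw (Rmin_l _ _)).
  assert (H2 := Rlt_le_trans _ _ _ Hw (Rmin_r _ _)).
  set (h := (w - z0)%C) in *.
  assert (HI : is_RInt (V := C_R_NormedModule)
    (fun t => h * (phi t * / (gam t - w) * / (gam t - w) * / (gam t - z0)
                  + phi t * / (gam t - w) * / (gam t - z0) * / (gam t - z0)))%C a b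
    (kernel2 w - kernel2 z0)%C).
  { apply is_RInt_ext with (fun t => (phi t * / (gam t - w) * / (gam t - w)
       - phi t * / (gam t - z0) * / (gam t - z0))%C).
    - rewrite Rmin_left, Rmax_right by auto; intros t Ht; unfold h.
      match goal with |- ?l = ?r => change (@eq C l r) end.
      field; split; apply kernel_neq_0; auto; lra.
    - apply (is_RInt_minus (V := C_R_NormedModule)); apply is_RInt_kernel2; auto. }
  apply (Cmod_RInt_le _ a b (Cmod h * (M * / r * / r * / r + M * / r * / r * / r))) in HI; auto.
  2:{ intros t Ht; rewrite (Cmod_mult h).
      apply Rmult_le_compat_l; [apply Cmod_ge_0|].
      eapply Rle_trans; [apply Cmod_triangle|].
      apply Rplus_le_compat; apply Cmod_mult4_le; auto using kernel_inv. }
  eapply Rle_lt_trans; [apply HI|].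
  replace ((b - a) * (Cmod h * (M * / r * / r * / r + M * / r * / r * / r))) with (B * Cmod h) by (unfold B; ring).
  apply Rle_lt_trans with ((B + 1) * Cmod h - Cmod h); [right; ring|].
  apply Rmult_lt_compat_l with (r := B + 1) in H2; [|lra].
  replace ((B + 1) * (eps / (B + 1))) with eps in H2 by (field; lra).
  pose proof (Cmod_ge_0 h); lra.
Qed.

End CauchyKernel.

(** The derivative exists on a neighbourhood, but its continuity is demanded only at [z]: this is
    what the kernels deliver and what a quotient preserves. *)
Definition C1_at (K : C -> C) (z : C) : Prop := exists K' : C -> C,
  (exists d, 0 < d /\ forall w, Cmod (w - z) < d -> is_Cderive K w (K' w)) /\
  continuous (T := C_UniformSpace) (U := C_UniformSpace) K' z.

Lemma C1_at_plus (F G : C -> C) (z : C) : C1_at F z -> C1_at G z -> C1_at (fun w => F w + G w)%C z.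
Proof.
  intros [F' [[d [d0 Hd]] HF]] [G' [[e [e0 He]] HG]]; exists (fun w => F' w + G' w)%C; split.
  - exists (Rmin d e); split; [apply Rmin_pos; auto|]; intros w Hw.
    apply (is_derive_plus (K := C_AbsRing) (V := C_NormedModule)).
    + apply Hd, (Rlt_le_trans _ _ _ Hw (Rmin_l _ _)).
    + apply He, (Rlt_le_trans _ _ _ Hw (Rmin_r _ _)).
  - apply continuous_Cplus; auto.
Qed.

Lemma C1_at_cmult (c : C) (F : C -> C) (z : C) : C1_at F z -> C1_at (fun w => c * F w)%C z.
Proof.
  intros [F' [[d [d0 Hd]] HF]]; exists (fun w => c * F' w)%C; split.
  - exists d; split; auto; intros w Hw; apply is_derive_C_cmult; auto.
  - apply continuous_Cmult; [apply continuous_const|auto].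
Qed.

(* Quotient rule read backwards: [f = J / I] with [I], [J] continuously differentiable. *)
Lemma continuous_derive_of_quotient (f I J : C -> C) (z : C) (r : R) :
  entire f -> 0 < r -> (forall w, Cmod (w - z) < r -> (f w * I w)%C = J w) ->
  I z <> RtoC 0 -> C1_at I z -> C1_at J z ->
  continuous (T := C_UniformSpace) (U := C_UniformSpace) (C_derive f) z.
Proof.
  intros Hf r0 HfIJ HI0 [I' [[d [d0 Hd]] HI]] [J' [[e [e0 He]] HJ]].
  assert (Df : forall w, is_Cderive f w (C_derive f w)).
  { intros w; apply (C_derive_correct f w (RtoC 0)), Hf. }
  assert (Hz : Cmod (z - z) = 0) by (unfold Cminus; rewrite Cplus_opp_r, Cmod_0; auto).
  assert (cI : continuous (T := C_UniformSpace) (U := C_UniformSpace) I z).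
  { apply is_derive_C_continuous with (I' z), Hd; lra. }
  assert (HIn : exists c, 0 < c /\ forall w, Cmod (w - z) < c -> I w <> RtoC 0).
  { destruct (proj1 (continuous_C_eps I z) cI (Cmod (I z))) as [c [c0 Hc]].
    { apply Cmod_gt_0; auto. }
    exists c; split; auto; intros w Hw E; specialize (Hc w Hw); rewrite E in Hc.
    replace (0 - I z)%C with (- I z)%C in Hc by ring; rewrite Cmod_opp in Hc; lra. }
  destruct HIn as [c [c0 Hc]].
  assert (HP : locally (T := C_UniformSpace) z (fun w => ((J' w - f w * I' w) * / I w)%C = C_derive f w)).
  (* Halving [r] leaves a disc of radius [r / 2] around each such [w] on which [f * I = J] still
     holds, so the product rule computes [J'] at [w] and can be solved for [f']. *)
  { apply locally_C_Cmod; exists (Rmin (Rmin d e) (Rmin c (r / 2))); split.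
    { repeat apply Rmin_pos; lra. }
    intros w Hw.
    pose proof (Rmin_l (Rmin d e) (Rmin c (r / 2))); pose proof (Rmin_r (Rmin d e) (Rmin c (r / 2))).
    pose proof (Rmin_l d e); pose proof (Rmin_r d e).
    pose proof (Rmin_l c (r / 2)); pose proof (Rmin_r c (r / 2)).
    assert (E1 : is_Cderive J w (C_derive f w * I w + f w * I' w)%C).
    { apply is_derive_C_ext_loc with (fun w => f w * I w)%C (r / 2); [lra| |].
      - intros w' Hw'; apply HfIJ.
        replace (w' - z)%C with ((w' - w) + (w - z))%C by ring.
        eapply Rle_lt_trans; [apply Cmod_triangle|lra].
      - apply is_derive_C_mult; auto; apply Hd; lra. }
    apply is_C_derive_unique in E1.
    rewrite (is_C_derive_unique J w (J' w)) in E1 by (apply He; lra).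
    rewrite E1; field; apply Hc; lra. }
  apply (continuous_ext_loc (T := C_UniformSpace) (U := C_UniformSpace) _ _ _ HP).
  apply continuous_Cmult; [|apply continuous_Cinv; auto].
  apply continuous_Cminus; auto; apply continuous_Cmult; auto.
  apply is_derive_C_continuous with (C_derive f z), Df.
Qed.

(** Divided difference, completed by [f'] at [w]. It is continuous everywhere and holomorphic off
    [w], which matches [goursat_except]; differentiability at [w] itself would take second-order
    information on [f]. *)
Definition slope (f : C -> C) (w z : C) : C :=
  match Ceq_dec z w with left _ => C_derive f w | right _ => ((f z - f w) * / (z - w))%C end.

Lemma slope_neq (f : C -> C) (w z : C) : z <> w -> slope f w z = ((f z - f w) * / (z - w))%C.
Proof. intros H; unfold slope; destruct (Ceq_dec z w); [contradiction|reflexivity]. Qed.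

Lemma is_derive_Cinv_shift (w z : C) : z <> w ->
  is_Cderive (fun z => / (z - w))%C z (- (/ (z - w) * / (z - w)))%C.
Proof.
  intros Hzw; apply is_derive_C_eps; intros eps He.
  assert (Hq : (z - w)%C <> RtoC 0) by (apply Cminus_eq_contra; auto).
  set (q := (z - w)%C) in *.
  assert (H0 : 0 < Cmod q) by (apply Cmod_gt_0; auto).
  (* The remainder is exactly [(y - z) ^ 2 / (q ^ 2 (y - w))], and [|y - w| >= |q| / 2] near [z];
     [B] is what [|y - z|] must stay below. *)
  set (B := eps * (Cmod q * Cmod q * (Cmod q / 2))).
  assert (B0 : 0 < B) by (unfold B; repeat apply Rmult_lt_0_compat; lra).
  exists (Rmin (Cmod q / 2) B); split; [apply Rmin_pos; lra|]; intros y Hy.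
  assert (H1 := Rlt_le_trans _ _ _ Hy (Rmin_l _ _)).
  assert (H2 := Rlt_le_trans _ _ _ Hy (Rmin_r _ _)).
  assert (H3 : Cmod q / 2 <= Cmod (y - w)).
  { pose proof (Cmod_sub_ge w y z).
    replace (w - z)%C with (- q)%C in H by (unfold q; ring).
    replace (w - y)%C with (- (y - w))%C in H by ring.
    rewrite !Cmod_opp in H; lra. }
  assert (Hp : (y - w)%C <> RtoC 0) by (apply Cmod_pos_neq_0; lra).
  replace (/ (y - w) - / q - - (/ q * / q) * (y - z))%C with
    ((y - z) * / (q * q * (y - w)) * (y - z))%C.
  2:{ unfold q in *; field; auto. }
  rewrite !Cmod_mult, Cmod_inv, !Cmod_mult by (repeat apply Cmult_neq_0; auto).
  apply Rmult_le_compat_r; [apply Cmod_ge_0|].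
  assert (H4 : 0 < Cmod q * Cmod q * Cmod (y - w)) by (repeat apply Rmult_lt_0_compat; lra).
  apply Rmult_le_reg_r with (Cmod q * Cmod q * Cmod (y - w)); auto.
  rewrite Rmult_assoc, Rinv_l, Rmult_1_r by lra.
  apply Rle_trans with B; [lra|]; unfold B; apply Rmult_le_compat_l; [lra|].
  apply Rmult_le_compat_l; [nra|lra].
Qed.

Lemma ex_derive_slope (f : C -> C) (w z : C) : entire f -> z <> w ->
  ex_derive (K := C_AbsRing) (V := C_NormedModule) (slope f w) z.
Proof.
  intros Hf Hzw; destruct (Hf z) as [l Hl].
  eexists; apply is_derive_C_ext_loc with (fun y => (f y - f w) * / (y - w))%C (Cmod (z - w)).
  - apply Cmod_gt_0, Cminus_eq_contra; auto.
  - intros y Hy; symmetry; apply slope_neq; intros E; subst y.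
    replace (w - z)%C with (- (z - w))%C in Hy by ring; rewrite Cmod_opp in Hy; lra.
  - apply is_derive_C_mult; [|apply is_derive_Cinv_shift; auto].
    apply (is_derive_minus (K := C_AbsRing) (V := C_NormedModule)); [exact Hl|].
    apply (is_derive_const (K := C_AbsRing) (V := C_NormedModule)).
Qed.

Lemma continuous_slope (f : C -> C) (w z : C) : entire f ->
  continuous (T := C_UniformSpace) (U := C_UniformSpace) (slope f w) z.
Proof.
  intros Hf; destruct (Ceq_dec z w) as [->|Hzw].
  - assert (Hd := C_derive_correct f w (RtoC 0) (Hf w)).
    apply continuous_C_eps; intros eps He.
    destruct (proj1 (is_derive_C_eps _ _ _) Hd (eps / 2)) as [d [d0 H]]; [lra|].
    exists d; split; auto; intros y Hy.
    destruct (Ceq_dec y w) as [->|Hyw].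
    { unfold Cminus; rewrite Cplus_opp_r, Cmod_0; auto. }
    rewrite (slope_neq f w y Hyw); unfold slope; destruct (Ceq_dec w w) as [_|N]; [|contradiction].
    assert (Hq : (y - w)%C <> RtoC 0) by (apply Cminus_eq_contra; auto).
    replace ((f y - f w) * / (y - w) - C_derive f w)%C with
      ((f y - f w - C_derive f w * (y - w)) * / (y - w))%C by (field; auto).
    rewrite Cmod_mult, Cmod_inv by auto.
    specialize (H y Hy); apply Cmod_gt_0 in Hq.
    apply Rle_lt_trans with (eps / 2); [|lra].
    apply Rmult_le_reg_r with (Cmod (y - w)); auto.
    rewrite Rmult_assoc, Rinv_l by lra; lra.
  - destruct (ex_derive_slope f w z Hf Hzw) as [l Hl]; apply is_derive_C_continuous with l, Hl.
Qed.

Lemma entire_continuous (f : C -> C) (z : C) : entire f ->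
  continuous (T := C_UniformSpace) (U := C_UniformSpace) f z.
Proof. intros Hf; destruct (Hf z) as [l Hl]; apply is_derive_C_continuous with l, Hl. Qed.

(** * Cauchy's formula on the square and continuity of the derivative *)

Definition square_side (k : nat) (t : R) : C :=
  match k with 0 => (t, -1) | 1 => (1, t) | 2 => (t, 1) | _ => (-1, t) end%R%nat.

(** The counterclockwise integral of [phi s / (s - w)]. All sides are parametrised by an increasing
    coordinate, so the factors 1, [i], -1, [-i] are tangents with the orientation included. *)
Definition square_int (phi : C -> C) (w : C) : C :=
  (kernel1 (fun t => phi (square_side 0 t)) (square_side 0) (-1) 1 w
   + (Ci * kernel1 (fun t => phi (square_side 1 t)) (square_side 1) (-1) 1 w
   + (RtoC (-1) * kernel1 (fun t => phi (square_side 2 t)) (square_side 2) (-1) 1 w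
   + - Ci * kernel1 (fun t => phi (square_side 3 t)) (square_side 3) (-1) 1 w)))%C.

Lemma continuous_square_side (k : nat) (t : R) : continuous (U := C_UniformSpace) (square_side k) t.
Proof.
  destruct k as [|[|[|k]]]; apply continuous_Re_Im; split; unfold Re, Im; simpl;
    apply continuous_const || apply (continuous_id (U := R_UniformSpace)).
Qed.

Lemma square_side_far (k : nat) (t : R) : 1 <= Cmod (square_side k t).
Proof.
  assert (H1 : Rabs 1 = 1) by (apply Rabs_pos_eq; lra).
  assert (H2 : Rabs (-1) = 1) by (rewrite Rabs_left; lra).
  destruct k as [|[|[|k]]]; simpl.
  - rewrite <- H2; apply (Rabs_Im_le (t, -1)).
  - rewrite <- H1 at 1; apply (Rabs_Re_le (1, t)).
  - rewrite <- H1 at 1; apply (Rabs_Im_le (t, 1)).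
  - rewrite <- H2; apply (Rabs_Re_le (-1, t)).
Qed.

(** Written in the shape of [Hdist], for the kernels with radius [1 / 2] around 0. *)
Lemma square_side_dist (k : nat) (t : R) : 2 * (1 / 2) <= Cmod (square_side k t - 0).
Proof.
  replace (square_side k t - 0)%C with (square_side k t) by ring.
  pose proof (square_side_far k t); lra.
Qed.

Lemma C1_at_square_int (phi : C -> C) : ccont phi -> C1_at (square_int phi) 0.
Proof.
  intros Hphi; unfold square_int.
  assert (H : forall k, C1_at (kernel1 (fun t => phi (square_side k t)) (square_side k) (-1) 1) 0).
  { intros k.
    assert (Hc : forall t, continuous (U := C_UniformSpace) (fun t => phi (square_side k t)) t).
    { intros t; apply (continuous_comp (V := C_UniformSpace) (W := C_UniformSpace) (square_side k)); auto.
      apply continuous_square_side. }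
    exists (kernel2 (fun t => phi (square_side k t)) (square_side k) (-1) 1); split.
    - exists (1 / 2); split; [lra|]; intros w Hw.
      apply is_derive_kernel1 with (1 / 2) (RtoC 0); auto using continuous_square_side; try lra.
      intros t _; apply square_side_dist.
    - apply continuous_kernel2 with (1 / 2); auto using continuous_square_side; try lra.
      intros t _; apply square_side_dist. }
  apply C1_at_plus; [apply (H 0%nat)|].
  apply C1_at_plus; [apply C1_at_cmult, (H 1%nat)|].
  apply C1_at_plus; [apply C1_at_cmult, (H 2%nat)|apply C1_at_cmult, (H 3%nat)].
Qed.

Lemma RI_slope_side (f : C -> C) (k : nat) (w : C) : entire f -> Cmod (w - 0) < 1 / 2 ->
  RI (fun t => slope f w (square_side k t)) (-1) 1 =
  (kernel1 (fun t => f (square_side k t)) (square_side k) (-1) 1 w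
   - f w * kernel1 (fun _ => RtoC 1) (square_side k) (-1) 1 w)%C.
Proof.
  intros Hf Hw; apply RI_unique.
  assert (Hc : forall t, continuous (U := C_UniformSpace) (fun t => f (square_side k t)) t).
  { intros t; apply (continuous_comp (V := C_UniformSpace) (W := C_UniformSpace) (square_side k)).
    - apply continuous_square_side.
    - apply entire_continuous, Hf. }
  apply is_RInt_ext with (fun t => (f (square_side k t) * / (square_side k t - w)
     - f w * (RtoC 1 * / (square_side k t - w)))%C).
  - intros t _; rewrite slope_neq.
    + match goal with |- ?l = ?r => change (@eq C l r) end; ring.
    + intros E; pose proof (square_side_far k t); rewrite E in H.
      replace (w - 0)%C with w in Hw by ring; lra.
  - apply (is_RInt_minus (V := C_R_NormedModule)); [|apply is_RInt_Cmult];
      apply is_RInt_kernel1 with (1 / 2) (RtoC 0); auto using continuous_square_side; try lra;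
      try (intros t _; apply square_side_dist); intros; apply continuous_const.
Qed.

(** Goursat's theorem for the divided difference, whose integral splits because [w] is off the
    boundary. The integral of [1 / (s - w)] is left unevaluated; it serves only as a divisor. *)
Theorem cauchy_square (f : C -> C) (w : C) : entire f -> Cmod (w - 0) < 1 / 2 ->
  (f w * square_int (fun _ => RtoC 1) w)%C = square_int f w.
Proof.
  intros Hf Hw.
  assert (H1 := Rabs_Re_le (w - 0)); assert (H2 := Rabs_Im_le (w - 0)).
  replace (w - 0)%C with w in H1, H2 by ring.
  replace (w - 0)%C with w in Hw by ring.
  assert (H3 := Rabs_def2 _ _ (Rle_lt_trans _ _ _ H1 Hw)).
  assert (H4 := Rabs_def2 _ _ (Rle_lt_trans _ _ _ H2 Hw)).
  assert (H := goursat_except (slope f w) (-1) 1 (-1) 1 (Re w) (Im w)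
    (fun z => continuous_slope f w z Hf) ltac:(lra) ltac:(lra)
    (fun z Hz => ex_derive_slope f w z Hf (fun E => Hz (eq_trans E (surjective_pairing w))))).
  unfold rect_int in H.
  replace w with (w - 0)%C in Hw by ring.
  change (RI (fun t => slope f w (square_side 0 t)) (-1) 1 + Ci * RI (fun t => slope f w (square_side 1 t)) (-1) 1
    - RI (fun t => slope f w (square_side 2 t)) (-1) 1 - Ci * RI (fun t => slope f w (square_side 3 t)) (-1) 1 = 0)%C in H.
  rewrite !RI_slope_side in H by assumption.
  unfold square_int.
  apply Ceq_minus.
  match goal with |- ?x = _ => replace x with (- (RtoC 0))%C; [ring|] end.
  rewrite <- H; replace (RtoC (-1)) with (- (1))%C by (rewrite <- RtoC_opp; f_equal; ring); ring.
Qed.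

(* At the centre the four sides add up to [4 i / (1 + t ^ 2)]. *)
Lemma square_int_1_neq_0 : square_int (fun _ => RtoC 1) 0 <> RtoC 0.
Proof.
  assert (H : is_RInt (V := C_R_NormedModule) (fun t => Ci * RtoC (4 / (1 + t ^ 2)))%C (-1) 1
     (square_int (fun _ => RtoC 1) 0)).
  { apply is_RInt_ext with (fun t => (RtoC 1 * / (square_side 0 t - 0)
      + (Ci * (RtoC 1 * / (square_side 1 t - 0)) + (RtoC (-1) * (RtoC 1 * / (square_side 2 t - 0))
      + - Ci * (RtoC 1 * / (square_side 3 t - 0)))))%C).
    - intros t _; simpl; match goal with |- ?l = ?r => change (@eq C l r) end.
      assert (1 + t ^ 2 <> 0) by nra.
      apply C_eq; unfold Re, Im; simpl; field; repeat split; nra.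
    - assert (HK : forall k, is_RInt (V := C_R_NormedModule) (fun t => RtoC 1 * / (square_side k t - 0))%C (-1) 1
        (kernel1 (fun _ => RtoC 1) (square_side k) (-1) 1 0)).
      { intros k; apply is_RInt_kernel1 with (1 / 2) (RtoC 0); auto using continuous_square_side; try lra;
        try (intros t _; apply square_side_dist); try (intros; apply continuous_const).
        replace (0 - 0)%C with (RtoC 0) by ring; rewrite Cmod_0; lra. }
      unfold square_int.
      apply (is_RInt_plus (V := C_R_NormedModule)); [apply (HK 0%nat)|].
      apply (is_RInt_plus (V := C_R_NormedModule)); [apply is_RInt_Cmult, (HK 1%nat)|].
      apply (is_RInt_plus (V := C_R_NormedModule)); [apply is_RInt_Cmult, (HK 2%nat)|apply is_RInt_Cmult, (HK 3%nat)]. }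
  apply is_RInt_Re_Im in H; destruct H as [_ H].
  intros E; rewrite E in H; simpl in H.
  (* On [[-1, 1]] one has [4 / (1 + t ^ 2) >= 2], so the imaginary part of the integral is at least
     4. *)
  assert (H2 := is_RInt_const (V := R_NormedModule) (-1) 1 2).
  assert (Hle := is_RInt_le _ _ (-1) 1 _ _ ltac:(lra) H2 H).
  assert (4 <= 0); [|lra].
  eapply Rle_trans; [|apply Hle].
  - unfold scal; simpl; unfold mult; simpl; lra.
  - intros t Ht; simpl.
    assert (H0 : 0 < 1 + t * (t * 1)) by nra.
    apply Rmult_le_reg_r with (1 + t * (t * 1)); [exact H0|].
    replace ((0 * 0 + 1 * (4 / (1 + t * (t * 1)))) * (1 + t * (t * 1))) with 4 by (field; lra); nra.
Qed.

(** Translation brings [z] to the centre of the square. Near 0 the translate is a quotient of two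
    Cauchy integrals, and both have derivatives continuous at 0. *)
Theorem entire_continuous_derive (f : C -> C) (z : C) : entire f ->
  continuous (T := C_UniformSpace) (U := C_UniformSpace) (C_derive f) z.
Proof.
  intros Hf; set (h := fun w => f (z + w)%C).
  assert (Hh : entire h).
  { intros w; destruct (Hf (z + w)%C) as [l Hl]; exists l; apply is_derive_C_translate, Hl. }
  assert (H : continuous (T := C_UniformSpace) (U := C_UniformSpace) (C_derive h) (RtoC 0)).
  { apply continuous_derive_of_quotient with (square_int (fun _ => RtoC 1)) (square_int h) (1 / 2); auto.
    - lra.
    - intros w Hw; apply cauchy_square; auto.
    - apply square_int_1_neq_0.
    - apply C1_at_square_int; intros; apply continuous_const.
    - apply C1_at_square_int; intros; apply entire_continuous, Hh. }
  assert (E : forall w, C_derive h w = C_derive f (z + w)%C).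
  { intros w; apply is_C_derive_unique, is_derive_C_translate, (C_derive_correct f (z + w)%C (RtoC 0)), Hf. }
  apply continuous_C_eps; intros eps He.
  destruct (proj1 (continuous_C_eps _ _) H eps He) as [d [d0 Hd]]; exists d; split; auto.
  intros w Hw; specialize (Hd (w - z)%C); rewrite !E in Hd.
  replace (w - z - 0)%C with (w - z)%C in Hd by ring.
  replace (z + (w - z))%C with w in Hd by ring.
  replace (z + 0)%C with z in Hd by ring; auto.
Qed.

(** * The Gamma recurrence *)

Local Notation is_Clim u l := (filterlim (u : nat -> C) eventually (locally (T := C_UniformSpace) l)).

Lemma is_Clim_eps (u : nat -> C) (l : C) :
  is_Clim u l <-> forall eps, 0 < eps -> exists N, forall n, (N <= n)%nat -> Cmod (u n - l) < eps.
Proof.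
  split.
  - intros H eps He; apply (H (fun y => Cmod (y - l) < eps)).
    apply locally_C_Cmod; exists eps; auto.
  - intros H P HP; apply locally_C_Cmod in HP; destruct HP as [d [d0 Hd]].
    destruct (H d d0) as [N HN]; exists N; auto.
Qed.

(** [lim] is total and specified only on Cauchy filters; a known limit yields the Cauchy property,
    and uniqueness then identifies the value. *)
Lemma lim_eq_of_is_Clim (u : nat -> C) (l : C) :
  is_Clim u l -> lim (T := C_CompleteNormedModule) (filtermap u eventually) = l.
Proof.
  intros H.
  assert (PF : ProperFilter (filtermap u eventually)) by (apply filtermap_proper_filter, eventually_filter).
  assert (HC : cauchy (T := C_CompleteNormedModule) (filtermap u eventually)).
  { intros eps; exists l; apply H; exists eps; auto. }
  assert (HL := complete_cauchy (T := C_CompleteNormedModule) _ PF HC).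
  apply (filterlim_locally_unique (V := C_NormedModule) (F := eventually) u); [|exact H].
  apply (filterlim_locally (U := C_UniformSpace)); exact HL.
Qed.

(* [1 / (n (n+1))] telescopes, so [|u n|] stays below [|u N| exp K] and the tails are [O(1/n)]. *)
Lemma is_Clim_of_ratio (u : nat -> C) (K : R) (N : nat) : 0 <= K -> (1 <= N)%nat ->
  (forall n, (N <= n)%nat -> Cmod (u (S n) - u n) <= K / (INR n * INR (S n)) * Cmod (u n)) ->
  exists l, is_Clim u l.
Proof.
  intros HK HN H.
  assert (Hpos : forall k, 1 <= INR (N + k)).
  { intros k; change 1 with (INR 1); apply le_INR; lia. }
  assert (Htel : forall k, / (INR (N + k) * INR (S (N + k))) = / INR (N + k) - / INR (S (N + k))).
  { intros k; rewrite S_INR; specialize (Hpos k); field; lra. }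
  (* The inequality [1 + y <= exp y] turns the product of ratios into the exponential of a
     telescoping sum. *)
  assert (Hb : forall k, Cmod (u (N + k)%nat) <= Cmod (u N) * exp (K * (/ INR N - / INR (N + k)))).
  { induction k as [|k IH].
    - rewrite Nat.add_0_r, Rminus_diag, Rmult_0_r, exp_0; lra.
    - rewrite Nat.add_succ_r.
      specialize (H (N + k)%nat ltac:(lia)).
      set (y := K / (INR (N + k) * INR (S (N + k)))) in *.
      assert (Hy : y = K * (/ INR (N + k) - / INR (S (N + k)))) by (unfold y, Rdiv; rewrite Htel; auto).
      assert (Hy0 : 0 <= y).
      { unfold y; apply Rmult_le_pos; auto; apply Rlt_le, Rinv_0_lt_compat; rewrite S_INR.
        specialize (Hpos k); nra. }
      assert (Cmod (u (S (N + k))) <= (1 + y) * Cmod (u (N + k)%nat)).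
      { replace (u (S (N + k))) with ((u (S (N + k)) - u (N + k)%nat) + u (N + k)%nat)%C by ring.
        eapply Rle_trans; [apply Cmod_triangle|]; lra. }
      eapply Rle_trans; [eassumption|].
      replace (K * (/ INR N - / INR (S (N + k)))) with (y + K * (/ INR N - / INR (N + k))) by (rewrite Hy; ring).
      rewrite exp_plus; pose proof (exp_ineq1_le y); pose proof (Cmod_ge_0 (u (N + k)%nat)).
      pose proof (exp_pos y).
      replace (Cmod (u N) * (exp y * exp (K * (/ INR N - / INR (N + k))))) with
        (exp y * (Cmod (u N) * exp (K * (/ INR N - / INR (N + k))))) by ring.
      apply Rmult_le_compat; lra. }
  set (B := Cmod (u N) * exp K).
  assert (HB0 : 0 <= B) by (apply Rmult_le_pos; [apply Cmod_ge_0|apply Rlt_le, exp_pos]).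
  assert (HB : forall k, Cmod (u (N + k)%nat) <= B).
  { intros k; eapply Rle_trans; [apply Hb|]; apply Rmult_le_compat_l; [apply Cmod_ge_0|].
    destruct HK as [HK| <-]; [|rewrite Rmult_0_l; lra].
    apply Rlt_le, exp_increasing; rewrite <- (Rmult_1_r K) at 2; apply Rmult_lt_compat_l; auto.
    assert (0 < / INR (N + k)) by (apply Rinv_0_lt_compat; specialize (Hpos k); lra).
    assert (/ INR N <= / 1) by (apply Rinv_le_contravar; [lra|]; specialize (Hpos 0%nat); rewrite Nat.add_0_r in *; lra).
    lra. }
  assert (HD : forall n k, (N <= n)%nat -> Cmod (u (n + k)%nat - u n) <= K * B * (/ INR n - / INR (n + k))).
  { intros n k Hn; induction k as [|k IH].
    - rewrite Nat.add_0_r; unfold Cminus; rewrite Cplus_opp_r, Cmod_0; lra.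
    - rewrite Nat.add_succ_r.
      replace (u (S (n + k)) - u n)%C with ((u (S (n + k)) - u (n + k)%nat) + (u (n + k)%nat - u n))%C by ring.
      eapply Rle_trans; [apply Cmod_triangle|].
      specialize (H (n + k)%nat ltac:(lia)).
      specialize (HB (n + k - N)%nat); specialize (Htel (n + k - N)%nat); specialize (Hpos (n + k - N)%nat).
      replace (N + (n + k - N))%nat with (n + k)%nat in * by lia.
      unfold Rdiv in H; rewrite Htel in H.
      assert (0 <= / INR (n + k) - / INR (S (n + k))).
      { rewrite <- Htel; apply Rlt_le, Rinv_0_lt_compat; rewrite S_INR; nra. }
      assert (K * (/ INR (n + k) - / INR (S (n + k))) * Cmod (u (n + k)%nat) <=
        K * (/ INR (n + k) - / INR (S (n + k))) * B).
      { apply Rmult_le_compat_l; auto; apply Rmult_le_pos; auto. }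
      lra. }
  apply (filterlim_locally_cauchy (U := C_CompleteNormedModule) u); intros [eps He].
  destruct (archimed_cor1 (eps / (2 * (K * B + 1)))) as [M [HM1 HM2]].
  { apply Rdiv_lt_0_compat; auto; nra. }
  set (n0 := (N + M)%nat).
  assert (Hn0 : forall n, (n0 <= n)%nat -> Cmod (u n - u n0) < eps / 2).
  { intros n Hn; replace n with (n0 + (n - n0))%nat by lia.
    eapply Rle_lt_trans; [apply HD; unfold n0; lia|].
    assert (0 < / INR (n0 + (n - n0))).
    { apply Rinv_0_lt_compat, lt_0_INR; lia. }
    assert (/ INR n0 <= / INR M).
    { apply Rinv_le_contravar; [apply lt_0_INR; auto|]; apply le_INR; unfold n0; lia. }
    assert (0 <= K * B) by nra.
    apply Rle_lt_trans with ((K * B + 1) * / INR M).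
    - assert (0 < / INR M) by (apply Rinv_0_lt_compat, lt_0_INR; auto); nra.
    - apply Rmult_lt_compat_l with (r := K * B + 1) in HM1; [|lra].
      replace ((K * B + 1) * (eps / (2 * (K * B + 1)))) with (eps / 2) in HM1 by (field; lra); auto. }
  exists (fun n => (n0 <= n)%nat); split; [exists n0; auto|]; intros p q Hp Hq.
  apply Cmod_ball; simpl.
  replace (u q - u p)%C with ((u q - u n0) + - (u p - u n0))%C by ring.
  eapply Rle_lt_trans; [apply Cmod_triangle|]; rewrite Cmod_opp.
  specialize (Hn0 p Hp) as H1; specialize (Hn0 q Hq) as H2; lra.
Qed.

(** * Taylor bounds for the exponential, bounds for the logarithm *)

Lemma is_derive_Rscal (w : C) (t : R) :
  is_derive (K := R_AbsRing) (V := C_R_NormedModule) (fun s => RtoC s * w)%C t w.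
Proof.
  replace (is_derive (K := R_AbsRing) (V := C_R_NormedModule) (fun s => RtoC s * w)%C t w) with
    (is_derive (K := R_AbsRing) (V := C_R_NormedModule) (fun s => RtoC s * w)%C t (RtoC 1 * w + RtoC t * 0)%C)
    by (f_equal; ring).
  apply (is_derive_Cmult_R (fun s => RtoC s) (fun _ => w)).
  - apply is_derive_RtoC, (is_derive_id (K := R_AbsRing)).
  - apply (is_derive_const (K := R_AbsRing) (V := C_R_NormedModule)).
Qed.

Lemma continuous_Cexp_Rscal (w : C) (t : R) :
  continuous (U := C_UniformSpace) (fun s => Cexp (RtoC s * w)) t.
Proof.
  apply (continuous_comp (V := C_UniformSpace) (W := C_UniformSpace) (fun s => RtoC s * w)%C Cexp);
    [|apply continuous_Cexp].
  apply continuous_Cmult; [|apply continuous_const].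
  apply continuous_RtoC, (continuous_id (U := R_UniformSpace)).
Qed.

Lemma Cmod_Cexp_Rscal_le (w : C) (t : R) : 0 <= t <= 1 -> Cmod (Cexp (RtoC t * w)) <= exp (Cmod w).
Proof.
  intros Ht; rewrite Cmod_Cexp, re_scal_l.
  assert (H : t * Re w <= Cmod w).
  { pose proof (Rabs_Re_le w); pose proof (Rle_abs (Re w)); pose proof (Cmod_ge_0 w); nra. }
  destruct H as [H|H]; [left; apply exp_increasing; auto|rewrite H; lra].
Qed.

(** The mean value theorem fails for complex values, so the increment is written as an integral of
    the derivative along the segment towards [w]. The second-order bound integrates this one once
    more. *)
Lemma Cmod_Cexp_sub_1_le (w : C) (t : R) : 0 <= t <= 1 ->
  Cmod (Cexp (RtoC t * w) - 1) <= Cmod w * exp (Cmod w).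
Proof.
  intros Ht.
  assert (H : is_RInt (V := C_R_NormedModule) (fun s => Cexp (RtoC s * w) * w)%C 0 t (Cexp (RtoC t * w) - 1)%C).
  { replace (RtoC 1) with (Cexp (RtoC 0 * w)) by (rewrite Cmult_0_l; apply Cexp_0).
    apply (is_RInt_derive (V := C_R_CompleteNormedModule) (fun s => Cexp (RtoC s * w))).
    - intros s _; apply is_derive_Cexp_R, is_derive_Rscal.
    - intros s _; apply continuous_Cmult; [apply continuous_Cexp_Rscal|apply continuous_const]. }
  apply (Cmod_RInt_le _ _ _ (exp (Cmod w) * Cmod w)) in H; [|lra|].
  - assert (0 <= exp (Cmod w) * Cmod w).
    { apply Rmult_le_pos; [apply Rlt_le, exp_pos|apply Cmod_ge_0]. }
    nra.
  - intros s Hs; rewrite Cmod_mult; apply Rmult_le_compat_r; [apply Cmod_ge_0|].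
    apply Cmod_Cexp_Rscal_le; lra.
Qed.

Lemma Cmod_Cexp_taylor2_le (w : C) : Cmod (Cexp w - 1 - w) <= Cmod w * Cmod w * exp (Cmod w).
Proof.
  assert (H : is_RInt (V := C_R_NormedModule) (fun s => w * (Cexp (RtoC s * w) - 1))%C 0 1 (Cexp w - 1 - w)%C).
  { replace (Cexp w - 1 - w)%C with ((Cexp (RtoC 1 * w) - RtoC 1 * w) - (Cexp (RtoC 0 * w) - RtoC 0 * w))%C.
    2:{ rewrite Cmult_1_l, Cmult_0_l, Cexp_0; ring. }
    apply (is_RInt_derive (V := C_R_CompleteNormedModule) (fun s => Cexp (RtoC s * w) - RtoC s * w)%C).
    - intros s _; replace (w * (Cexp (RtoC s * w) - 1))%C with (Cexp (RtoC s * w) * w - w)%C by ring.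
      apply (is_derive_minus (K := R_AbsRing) (V := C_R_NormedModule)); [apply is_derive_Cexp_R|]; apply is_derive_Rscal.
    - intros s _; apply continuous_Cmult; [apply continuous_const|].
      apply continuous_Cminus; [apply continuous_Cexp_Rscal|apply continuous_const]. }
  apply (Cmod_RInt_le _ _ _ (Cmod w * (Cmod w * exp (Cmod w)))) in H; [lra|lra|].
  intros s Hs; rewrite Cmod_mult; apply Rmult_le_compat_l; [apply Cmod_ge_0|].
  apply Cmod_Cexp_sub_1_le; lra.
Qed.

Lemma ln_le_sub_1 (y : R) : 0 < y -> ln y <= y - 1.
Proof. intros Hy; pose proof (exp_ineq1_le (ln y)); rewrite exp_ln in H by auto; lra. Qed.

(** Both bounds are [ln y <= y - 1], taken at [x / (x + 1)] and at [(x + 1) / x]. *)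
Lemma ln_succ_bounds (x : R) : 0 < x -> / (x + 1) <= ln (x + 1) - ln x <= / x.
Proof.
  intros Hx; rewrite <- ln_div by lra; split.
  - assert (H := ln_le_sub_1 (x / (x + 1)) ltac:(apply Rdiv_lt_0_compat; lra)).
    rewrite ln_div in * by lra.
    replace (x / (x + 1) - 1) with (- / (x + 1)) in H by (field; lra); lra.
  - assert (H := ln_le_sub_1 ((x + 1) / x) ltac:(apply Rdiv_lt_0_compat; lra)).
    replace ((x + 1) / x - 1) with (/ x) in H by (field; lra); lra.
Qed.

(** * Convergence of Gauss' limit and the functional equation *)

Section GammaRecurrence.

Context (z : C).
Hypothesis Hz : forall n : nat, (z + RtoC (INR n))%C <> RtoC 0.

Lemma poch_prod_neq_0 (n : nat) : poch_prod z n <> RtoC 0.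
Proof.
  induction n as [|n IH]; [|apply Cmult_neq_0; auto].
  simpl; specialize (Hz 0%nat); simpl in Hz; rewrite Cplus_0_r in Hz; auto.
Qed.

Lemma Gamma_seq_succ (n : nat) : (1 <= n)%nat ->
  Gamma_seq z (S n) =
  (Gamma_seq z n * (RtoC (INR (S n)) * Cexp (z * RtoC (ln (INR (S n)) - ln (INR n)))) / (z + RtoC (INR (S n))))%C.
Proof.
  intros Hn; unfold Gamma_seq, Cpowr; rewrite fact_simpl, mult_INR, RtoC_mult.
  replace (Cexp (z * RtoC (ln (INR (S n))))) with
    (Cexp (z * RtoC (ln (INR n))) * Cexp (z * RtoC (ln (INR (S n)) - ln (INR n))))%C.
  2:{ rewrite <- Cexp_plus; f_equal; rewrite RtoC_minus; ring. }
  change (poch_prod z (S n)) with (poch_prod z n * (z + RtoC (INR (S n))))%C.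
  field; split; apply (Hz (S n)) || apply poch_prod_neq_0.
Qed.

(** With [L = ln (n + 1) - ln n], the ratio minus 1 has numerator [(n + 1) (exp (z L) - 1 - z L) + z
    ((n + 1) L - 1)]. The first-order terms have cancelled: both summands are [O(1/n)], and the
    denominator [z + n + 1] contributes another [1/n]. *)
Lemma is_Clim_Gamma_seq : exists l, is_Clim (Gamma_seq z) l.
Proof.
  set (A := Cmod z); assert (HA : 0 <= A) by apply Cmod_ge_0.
  destruct (nfloor_ex (2 * A) ltac:(lra)) as [N [_ HN]].
  (* The inner 2 bounds [1 + / x]. The outer one comes from [|z + n + 1| >= (n + 1) / 2], which
     holds because [n >= 2 * A]. *)
  set (K := 2 * (2 * (A * A * exp A) + A)).
  assert (HeA : 0 <= A * A * exp A).
  { apply Rmult_le_pos; [nra|apply Rlt_le, exp_pos]. }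
  apply is_Clim_of_ratio with K (S N); [unfold K; lra|lia|]; intros n Hn.
  assert (Hx : 1 <= INR n) by (change 1 with (INR 1); apply le_INR; lia).
  assert (HnA : 2 * A <= INR n).
  { apply Rlt_le, Rlt_le_trans with (1 := HN); rewrite <- S_INR; apply le_INR; lia. }
  rewrite Gamma_seq_succ by lia.
  set (L := ln (INR (S n)) - ln (INR n)).
  assert (HL : / (INR n + 1) <= L <= / INR n).
  { unfold L; rewrite S_INR; apply ln_succ_bounds; lra. }
  set (x := INR n) in *.
  assert (HD : (z + RtoC (INR (S n)))%C <> RtoC 0) by apply Hz.
  rewrite S_INR in *; fold x in HD |- *.
  assert (HDm : (x + 1) / 2 <= Cmod (z + RtoC (x + 1))).
  { pose proof (Cmod_triangle (z + RtoC (x + 1)) (- z)).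
    replace (z + RtoC (x + 1) + - z)%C with (RtoC (x + 1)) in H by ring.
    rewrite Cmod_opp, Cmod_R, Rabs_pos_eq in H by lra; fold A in H; lra. }
  replace (Gamma_seq z n * (RtoC (x + 1) * Cexp (z * RtoC L)) / (z + RtoC (x + 1)) - Gamma_seq z n)%C
    with ((RtoC (x + 1) * (Cexp (z * RtoC L) - 1 - z * RtoC L) + z * RtoC ((x + 1) * L - 1))
          / (z + RtoC (x + 1)) * Gamma_seq z n)%C.
  2:{ rewrite RtoC_minus, !RtoC_mult, RtoC_plus; rewrite RtoC_plus in HD; field; exact HD. }
  rewrite Cmod_mult; apply Rmult_le_compat_r; [apply Cmod_ge_0|].
  rewrite Cmod_div by auto.
  assert (Hix : 0 < / x <= 1).
  { split; [apply Rinv_0_lt_compat; lra|]; rewrite <- Rinv_1; apply Rinv_le_contravar; lra. }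
  assert (HL0 : 0 < L) by (pose proof (Rinv_0_lt_compat (x + 1) ltac:(lra)); lra).
  assert (HzL : Cmod (z * RtoC L) <= A * / x).
  { rewrite Cmod_mult, Cmod_R, Rabs_pos_eq by lra; apply Rmult_le_compat_l; auto; lra. }
  assert (HT : Cmod (Cexp (z * RtoC L) - 1 - z * RtoC L) <= (A * / x) * (A * / x) * exp A).
  { eapply Rle_trans; [apply Cmod_Cexp_taylor2_le|].
    pose proof (Cmod_ge_0 (z * RtoC L)).
    apply Rmult_le_compat; [apply Rmult_le_pos; auto|apply Rlt_le, exp_pos|apply Rmult_le_compat; auto|].
    - assert (Hle : Cmod (z * RtoC L) <= A) by nra.
      destruct Hle as [Hle|Hle]; [left; apply exp_increasing; auto|rewrite Hle; lra]. }
  assert (Hnum : Cmod (RtoC (x + 1) * (Cexp (z * RtoC L) - 1 - z * RtoC L) + z * RtoC ((x + 1) * L - 1))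
     <= (2 * (A * A * exp A) + A) * / x).
  { eapply Rle_trans; [apply Cmod_triangle|].
    rewrite !Cmod_mult, !Cmod_R, (Rabs_pos_eq (x + 1)) by lra; fold A.
    assert (H1 : (x + 1) * L <= (x + 1) * / x) by (apply Rmult_le_compat_l; lra).
    assert (H2 : (x + 1) * / (x + 1) <= (x + 1) * L) by (apply Rmult_le_compat_l; lra).
    rewrite Rinv_r in H2 by lra.
    replace ((x + 1) * / x) with (1 + / x) in H1 by (field; lra).
    rewrite Rabs_pos_eq by lra.
    assert (H3 : (x + 1) * Cmod (Cexp (z * RtoC L) - 1 - z * RtoC L) <= (x + 1) * (A * / x * (A * / x) * exp A)).
    { apply Rmult_le_compat_l; lra. }
    replace ((x + 1) * (A * / x * (A * / x) * exp A)) with ((1 + / x) * (A * A * exp A) * / x) in H3 by (field; lra).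
    assert (H4 : (1 + / x) * (A * A * exp A) * / x <= 2 * (A * A * exp A) * / x).
    { apply Rmult_le_compat_r; [lra|]; apply Rmult_le_compat_r; lra. }
    assert (H5 : A * ((x + 1) * L - 1) <= A * / x) by (apply Rmult_le_compat_l; lra).
    lra. }
  apply Rle_trans with ((2 * (A * A * exp A) + A) * / x * / ((x + 1) / 2)).
  - apply Rmult_le_compat; auto; [apply Cmod_ge_0| |].
    + apply Rlt_le, Rinv_0_lt_compat; lra.
    + apply Rinv_le_contravar; lra.
  - right; unfold K; field; lra.
Qed.

(** Both sides are [z (z + 1) ... (z + n + 1)], with the first or the last factor split off. *)
Lemma poch_prod_shift (n : nat) : (z * poch_prod (z + 1) n = poch_prod z n * (z + RtoC (INR (S n))))%C.
Proof.
  induction n as [|n IH]; [simpl; ring|].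
  change (poch_prod (z + 1) (S n)) with (poch_prod (z + 1) n * (z + 1 + RtoC (INR (S n))))%C.
  change (poch_prod z (S n)) with (poch_prod z n * (z + RtoC (INR (S n))))%C.
  rewrite Cmult_assoc, IH, (S_INR (S n)), RtoC_plus; ring.
Qed.

(** The sequence at [z + 1] is [z] times the sequence at [z] times [n / (z + n + 1)], and the last
    factor tends to 1. *)
Theorem CGamma_succ : CGamma (z + 1) = (z * CGamma z)%C.
Proof.
  destruct is_Clim_Gamma_seq as [l Hl]; unfold CGamma.
  rewrite (lim_eq_of_is_Clim _ _ Hl); apply lim_eq_of_is_Clim.
  assert (Hz0 : z <> RtoC 0) by (specialize (Hz 0%nat); simpl in Hz; rewrite Cplus_0_r in Hz; auto).
  assert (Hq : is_Clim (fun n => RtoC (INR n) / (z + RtoC (INR (S n))))%C (RtoC 1)).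
  { apply is_Clim_eps; intros eps He.
    set (A := Cmod (z + 1)); assert (HA : 0 <= A) by apply Cmod_ge_0.
    (* Beyond [T] one has [n > 2 * A], so the denominator exceeds [n / 2], and [n > 2 * A / eps], so
       [A < eps * (n / 2)]. *)
    set (T := 2 * A / eps + 2 * A + 1).
    assert (HAe : 0 <= 2 * A / eps) by (apply Rmult_le_pos; [lra|apply Rlt_le, Rinv_0_lt_compat; auto]).
    destruct (nfloor_ex T ltac:(unfold T; lra)) as [N [_ HN]].
    exists (S N); intros n Hn.
    assert (HT : T < INR n).
    { apply Rlt_le_trans with (1 := HN); rewrite <- S_INR; apply le_INR; auto. }
    replace (RtoC (INR n) / (z + RtoC (INR (S n))) - 1)%C with (- ((z + 1) / (z + RtoC (INR (S n)))))%C.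
    2:{ assert (H0 := Hz (S n)); rewrite S_INR, RtoC_plus in *; field; auto. }
    rewrite Cmod_opp, Cmod_div by auto; fold A.
    assert (HD : INR n / 2 < Cmod (z + RtoC (INR (S n)))).
    { pose proof (Cmod_triangle (z + RtoC (INR (S n))) (- (z + 1))).
      rewrite S_INR, RtoC_plus in *.
      replace (z + (RtoC (INR n) + 1) + - (z + 1))%C with (RtoC (INR n)) in H by ring.
      rewrite Cmod_opp, Cmod_R, Rabs_pos_eq in H by apply pos_INR; fold A in H.
      unfold T in HT; lra. }
    apply Rmult_lt_reg_r with (Cmod (z + RtoC (INR (S n)))); [unfold T in HT; lra|].
    replace (A / Cmod (z + RtoC (INR (S n))) * Cmod (z + RtoC (INR (S n)))) with A.
    2:{ field; apply Rgt_not_eq; unfold T in HT; lra. }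
    apply Rlt_trans with (eps * (INR n / 2)); [|apply Rmult_lt_compat_l; auto].
    apply Rlt_le_trans with (eps * (T / 2)).
    - unfold T; replace (eps * ((2 * A / eps + 2 * A + 1) / 2)) with (A + eps * (A + 1 / 2)) by (field; lra).
      assert (0 < eps * (A + 1 / 2)) by (apply Rmult_lt_0_compat; lra); lra.
    - apply Rmult_le_compat_l; lra. }
  apply filterlim_ext_loc with (fun n => z * (Gamma_seq z n * (RtoC (INR n) / (z + RtoC (INR (S n))))))%C.
  (* At [n = 0] the default value of [ln 0] breaks [n ^ (z + 1) = n ^ z * n]. *)
  - exists 1%nat; intros n Hn; unfold Gamma_seq, Cpowr.
    assert (H0 : poch_prod (z + 1) n = (poch_prod z n * (z + RtoC (INR (S n))) / z)%C).
    { rewrite <- poch_prod_shift; field; auto. }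
    rewrite H0.
    assert (Hn0 : 0 < INR n) by (apply lt_0_INR; lia).
    replace (Cexp ((z + 1) * RtoC (ln (INR n)))) with (Cexp (z * RtoC (ln (INR n))) * RtoC (INR n))%C.
    2:{ rewrite Cmult_plus_distr_r, Cexp_plus, Cmult_1_l; f_equal.
        apply C_eq; unfold Cexp, Re, Im; simpl; rewrite exp_ln, ?cos_0, ?sin_0 by auto; ring. }
    field; repeat split; auto using poch_prod_neq_0.
  - replace (z * l)%C with (z * (l * RtoC 1))%C by ring.
    assert (Hm : forall u v a b, is_Clim u a -> is_Clim v b -> is_Clim (fun n => u n * v n)%C (a * b)%C).
    { intros u v a b Hu Hv.
      apply (filterlim_comp_2 (G := locally (T := C_UniformSpace) a) (H := locally (T := C_UniformSpace) b) u v Cmult); auto.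
      assert (Hc := continuous_Cmult (U := prod_UniformSpace C_UniformSpace C_UniformSpace) fst snd (a, b)
        (continuous_fst a b) (continuous_snd a b)).
      intros P HP; apply Hc in HP; destruct HP as [d Hd].
      exists (ball a d) (ball b d); try (apply locally_ball).
      intros x y Hx Hy; apply (Hd (x, y)); split; auto. }
    apply Hm; [apply filterlim_const|]; apply Hm; auto.
Qed.

End GammaRecurrence.

(** * The Hankel contour integral *)

Local Notation is_RInt_ray f l :=
  (is_RInt_gen (V := C_R_NormedModule) f (at_point 1) (Rbar_locally p_infty) l).

Lemma is_RInt_ray_ext (f g : R -> C) (l : C) :
  (forall t, 1 <= t -> f t = g t) -> is_RInt_ray f l -> is_RInt_ray g l.
Proof.
  intros H; apply is_RInt_gen_ext.
  apply (Filter_prod _ _ _ (fun a => a = 1) (fun b => 1 < b)); [reflexivity|exists 1; auto|].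
  intros a b -> Hb t; simpl; rewrite Rmin_left by lra; intros Ht; apply H; lra.
Qed.

Lemma is_RInt_ray_Cmult (c : C) (f : R -> C) (l : C) :
  is_RInt_ray f l -> is_RInt_ray (fun t => c * f t)%C (c * l)%C.
Proof.
  intros H P HP.
  assert (Hc : continuous (T := C_UniformSpace) (U := C_UniformSpace) (fun z => c * z)%C l).
  { apply continuous_Cmult; [apply continuous_const|apply continuous_id]. }
  generalize (H _ (Hc P HP)); unfold filtermapi; apply filter_imp.
  intros ab [y [Hy1 Hy2]]; exists (c * y)%C; split; [apply is_RInt_Cmult|]; auto.
Qed.

Lemma is_RInt_ray_of_lim (h F : R -> C) (l : C) :
  (forall b, 1 <= b -> is_RInt (V := C_R_NormedModule) h 1 b (F b)) ->
  filterlim F (Rbar_locally p_infty) (locally (T := C_UniformSpace) l) -> is_RInt_ray h l.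
Proof.
  intros H HF P HP; unfold filtermapi.
  apply (Filter_prod _ _ _ (fun a => a = 1) (fun b => 1 < b /\ P (F b))); [reflexivity| |].
  - apply filter_and; [exists 1; auto|apply HF, HP].
  - intros a b -> [Hb HPb]; exists (F b); split; auto; apply H; simpl; lra.
Qed.

Lemma Rexp_decay (c K eps : R) : 0 < c -> 0 <= K -> 0 < eps ->
  exists T, forall t, T <= t -> K * exp (- c * t) < eps.
Proof.
  intros Hc HK He; exists ((ln ((K + 1) / eps)) / c); intros t Ht.
  assert (HA : 0 < (K + 1) / eps) by (apply Rdiv_lt_0_compat; lra).
  apply Rmult_le_compat_l with (r := c) in Ht; [|lra].
  replace (c * (ln ((K + 1) / eps) / c)) with (ln ((K + 1) / eps)) in Ht by (field; lra).
  apply Rlt_le_trans with ((K + 1) * exp (- c * t)).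
  - pose proof (exp_pos (- c * t)); nra.
  - assert (H : exp (- c * t) <= / ((K + 1) / eps)).
    { rewrite <- (exp_ln ((K + 1) / eps)), <- exp_Ropp by auto.
      assert (H : - c * t <= - ln ((K + 1) / eps)) by lra.
      destruct H as [H|H]; [left; apply exp_increasing; auto|rewrite H; lra]. }
    apply Rmult_le_compat_l with (r := K + 1) in H; [|lra].
    replace ((K + 1) * / ((K + 1) / eps)) with eps in H by (field; lra); auto.
Qed.

(** Partial integrals up to [u <= v] differ by at most the exponential tail [K / c * exp (- c * u)],
    so they form a Cauchy family. *)
Lemma ex_RInt_ray (h : R -> C) (c K T : R) : 0 < c -> 0 <= K ->
  (forall t, 1 <= t -> continuous (U := C_UniformSpace) h t) ->
  (forall t, T <= t -> Cmod (h t) <= K * exp (- c * t)) ->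
  exists l, is_RInt_ray h l.
Proof.
  intros Hc HK Hh HT.
  assert (HI : forall a b, 1 <= a -> 1 <= b -> is_RInt (V := C_R_NormedModule) h a b (RI h a b)).
  { intros a b Ha Hb; apply is_RInt_RI; intros t Ht; apply Hh.
    apply Rle_trans with (2 := proj1 Ht), Rmin_glb; auto. }
  assert (HB : forall u v, 1 <= u -> T <= u -> u <= v -> Cmod (RI h 1 v - RI h 1 u) <= K / c * exp (- c * u)).
  { intros u v Hu1 HuT Huv.
    replace (RI h 1 v - RI h 1 u)%C with (RI h u v).
    2:{ rewrite (RI_unique h 1 v (RI h 1 u + RI h u v)%C); [ring|].
        apply (is_RInt_Chasles (V := C_R_NormedModule) h 1 u v); apply HI; lra. }
    assert (HE : is_RInt (fun t => K * exp (- c * t)) u v (- (K / c) * exp (- c * v) - - (K / c) * exp (- c * u))).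
    { apply (is_RInt_derive (V := R_CompleteNormedModule) (fun t => - (K / c) * exp (- c * t))).
      - intros t _; auto_derive; auto; field; lra.
      - intros t _; apply (continuous_mult (K := R_AbsRing)); [apply continuous_const|].
        apply (continuous_comp (fun t => - c * t) exp); [|apply continuous_exp].
        apply (continuous_mult (K := R_AbsRing)); [apply continuous_const|apply continuous_id]. }
    rewrite <- norm_C_R.
    eapply Rle_trans; [apply (norm_RInt_le (V := C_R_NormedModule) h (fun t => K * exp (- c * t)) u v) with (3 := HI u v Hu1 (Rle_trans _ _ _ Hu1 Huv)) (4 := HE); auto|].
    - intros t Ht; rewrite norm_C_R; apply HT; lra.
    - assert (0 <= K / c * exp (- c * v)).
      { apply Rmult_le_pos; [apply Rmult_le_pos; auto; apply Rlt_le, Rinv_0_lt_compat; auto|apply Rlt_le, exp_pos]. }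
      lra. }
  assert (HL : exists l : C, filterlim (fun b => RI h 1 b) (Rbar_locally p_infty) (locally (T := C_UniformSpace) l)).
  { apply (filterlim_locally_cauchy (U := C_R_CompleteNormedModule) (fun b => RI h 1 b)); intros [eps He].
    destruct (Rexp_decay c (K / c) (eps / 2) Hc) as [S HS]; [|lra|].
    { apply Rmult_le_pos; auto; apply Rlt_le, Rinv_0_lt_compat; auto. }
    set (u0 := Rmax (Rmax 1 T) S).
    assert (E : 1 <= u0 /\ T <= u0 /\ S <= u0).
    { unfold u0; pose proof (Rmax_l (Rmax 1 T) S); pose proof (Rmax_r (Rmax 1 T) S).
      pose proof (Rmax_l 1 T); pose proof (Rmax_r 1 T); lra. }
    destruct E as [E1 [E2 E3]].
    assert (HQ : forall v, u0 < v -> Cmod (RI h 1 v - RI h 1 u0) < eps / 2).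
    { intros v Hv; eapply Rle_lt_trans; [apply HB; lra|]; apply HS; auto. }
    exists (fun v => u0 < v); split; [exists u0; auto|]; intros p q Hp Hq.
    apply Cmod_ball; simpl.
    replace (RI h 1 q - RI h 1 p)%C with ((RI h 1 q - RI h 1 u0) + - (RI h 1 p - RI h 1 u0))%C by ring.
    eapply Rle_lt_trans; [apply Cmod_triangle|]; rewrite Cmod_opp.
    assert (H1 := HQ p Hp); assert (H2 := HQ q Hq); lra. }
  destruct HL as [l Hl]; exists l.
  apply is_RInt_ray_of_lim with (fun b => RI h 1 b); auto.
  intros b Hb; apply HI; lra.
Qed.

Definition hankel_circle (f : C -> C) (x : C) (th : R) : C :=
  (hankel_integrand f x (Cexp (Ci * RtoC th)) th * (Ci * Cexp (Ci * RtoC th)))%C.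

Definition hankel_ray (f : C -> C) (x : C) (al : R) (t : R) : C :=
  hankel_integrand f x (RtoC (- t)) al.

(** Records that each piece converges, which a value of [hankel_int] alone does not reveal. Both
    rays run outwards in [t = -s]; since [ds = - dt], the incoming lower edge counts positively and
    the outgoing upper edge negatively. *)
Definition is_hankel (f : C -> C) (x l : C) : Prop := exists l1 l2 l3 : C,
  is_RInt_ray (hankel_ray f x (- PI)) l1 /\
  is_RInt (V := C_R_NormedModule) (hankel_circle f x) (- PI) PI l2 /\
  is_RInt_ray (hankel_ray f x PI) l3 /\ l = (l1 + l2 - l3)%C.

Lemma is_hankel_unique (f : C -> C) (x l : C) : is_hankel f x l -> hankel_int f x = l.
Proof.
  intros [l1 [l2 [l3 [H1 [H2 [H3 ->]]]]]].
  apply (is_RInt_gen_unique (V := C_R_CompleteNormedModule)) in H1.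
  apply (is_RInt_gen_unique (V := C_R_CompleteNormedModule)) in H3.
  apply (is_RInt_unique (V := C_R_CompleteNormedModule)) in H2.
  rewrite <- H1, <- H2, <- H3; reflexivity.
Qed.

Lemma is_hankel_linear (f g : C -> C) (a b x l m : C) :
  is_hankel f x l -> is_hankel g x m ->
  is_hankel (fun s => a * f s + b * g s)%C x (a * l + b * m)%C.
Proof.
  intros [l1 [l2 [l3 [H1 [H2 [H3 ->]]]]]] [m1 [m2 [m3 [K1 [K2 [K3 ->]]]]]].
  exists (a * l1 + b * m1)%C, (a * l2 + b * m2)%C, (a * l3 + b * m3)%C.
  assert (Hray : forall al l m, is_RInt_ray (hankel_ray f x al) l -> is_RInt_ray (hankel_ray g x al) m ->
    is_RInt_ray (hankel_ray (fun s => a * f s + b * g s)%C x al) (a * l + b * m)%C).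
  { intros al l m Hl Hm.
    apply is_RInt_ray_ext with (fun t => a * hankel_ray f x al t + b * hankel_ray g x al t)%C.
    - intros t _; unfold hankel_ray, hankel_integrand; ring.
    - apply (is_RInt_gen_plus (V := C_R_NormedModule)); apply is_RInt_ray_Cmult; auto. }
  split; [auto|split; [|split; [auto|ring]]].
  apply is_RInt_ext with (fun t => a * hankel_circle f x t + b * hankel_circle g x t)%C.
  - intros t _; match goal with |- ?l = ?r => change (@eq C l r) end.
    unfold hankel_circle, hankel_integrand; ring.
  - apply (is_RInt_plus (V := C_R_NormedModule)); apply is_RInt_Cmult; auto.
Qed.

(** * The power of [-s] on the contour, and multiplication by [s] *)

Definition ray_power (x : C) (al t : R) : C :=
  Cexp ((- x - 1) * (RtoC (ln t) + Ci * RtoC (al - PI)))%C.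

Lemma hankel_ray_eq (f : C -> C) (x : C) (al t : R) : 0 < t ->
  hankel_ray f x al t = (f (RtoC (- t)) * Cexp (RtoC (- t)) * ray_power x al t)%C.
Proof.
  intros Ht; unfold hankel_ray, hankel_integrand, ray_power.
  rewrite Cmod_R, Rabs_Ropp, Rabs_pos_eq by lra; reflexivity.
Qed.

Definition circle_power (x : C) (th : R) : C := Cexp ((- x - 1) * (Ci * RtoC (th - PI)))%C.

Lemma hankel_integrand_circle (f : C -> C) (x : C) (th : R) :
  hankel_integrand f x (Cexp (Ci * RtoC th)) th =
  (f (Cexp (Ci * RtoC th)) * Cexp (Cexp (Ci * RtoC th)) * circle_power x th)%C.
Proof.
  unfold hankel_integrand, circle_power; rewrite Cmod_Cexp.
  replace (Re (Ci * RtoC th)) with 0 by (unfold Re; simpl; ring).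
  rewrite exp_0, ln_1; f_equal; f_equal.
  change Defs.Ci with Ci; ring.
Qed.

Lemma Cexp_Ci_PI : Cexp (Ci * RtoC PI) = RtoC (-1).
Proof.
  apply C_eq; unfold Cexp, Re, Im; simpl; rewrite !Rmult_0_l, !Rmult_1_l, Rminus_diag, exp_0, Rplus_0_l, ?cos_PI, ?sin_PI; ring.
Qed.

Lemma Cexp_Ci_opp_PI : Cexp (Ci * RtoC (- PI)) = RtoC (-1).
Proof.
  apply C_eq; unfold Cexp, Re, Im; simpl; rewrite !Rmult_0_l, !Rmult_1_l, Rminus_diag, exp_0, Rplus_0_l, ?cos_neg, ?sin_neg, ?cos_PI, ?sin_PI; ring.
Qed.

Definition edge_arg (al : R) : Prop := al = - PI \/ al = PI.

Lemma edge_arg_Cexp (al : R) : edge_arg al -> Cexp (Ci * RtoC al) = RtoC (-1).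
Proof. intros [-> | ->]; [apply Cexp_Ci_opp_PI|apply Cexp_Ci_PI]. Qed.

(** The argument of [-s] is [-2 * PI] on the lower edge and 0 on the upper one, so shifting the
    exponent by an integer has the same effect on both. *)
Lemma edge_arg_branch (al : R) : edge_arg al -> Cexp (Ci * RtoC (al - PI)) = RtoC 1.
Proof.
  intros H; replace (Ci * RtoC (al - PI))%C with (Ci * RtoC al + - (Ci * RtoC PI))%C by (rewrite RtoC_minus; ring).
  rewrite Cexp_plus, Cexp_opp, edge_arg_Cexp, Cexp_Ci_PI by auto.
  apply Cinv_r; intros E; apply RtoC_inj in E; lra.
Qed.

Lemma Cexp_RtoC_ln (t : R) : 0 < t -> Cexp (RtoC (ln t)) = RtoC t.
Proof.
  intros Ht; apply C_eq; unfold Cexp, Re, Im; simpl; rewrite exp_ln, ?cos_0, ?sin_0 by auto; ring.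
Qed.

Lemma ray_power_shift (x : C) (al t : R) : edge_arg al -> 0 < t ->
  (RtoC t * ray_power (x + 1) al t)%C = ray_power x al t.
Proof.
  intros Hal Ht; unfold ray_power.
  replace ((- x - 1) * (RtoC (ln t) + Ci * RtoC (al - PI)))%C with
    (RtoC (ln t) + (Ci * RtoC (al - PI) + (- (x + 1) - 1) * (RtoC (ln t) + Ci * RtoC (al - PI))))%C by ring.
  rewrite !Cexp_plus, edge_arg_branch, Cexp_RtoC_ln by auto; ring.
Qed.

(** The multiplier is [s = - (-s)] here, whereas on the edges it is [t = -s]; hence the minus
    sign. *)
Lemma circle_power_shift (x : C) (th : R) :
  (Cexp (Ci * RtoC th) * circle_power (x + 1) th)%C = (- circle_power x th)%C.
Proof.
  unfold circle_power.
  replace ((- x - 1) * (Ci * RtoC (th - PI)))%C with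
    (- (Ci * RtoC PI) + (Ci * RtoC th + (- (x + 1) - 1) * (Ci * RtoC (th - PI))))%C
    by (rewrite RtoC_minus; ring).
  rewrite !Cexp_plus, Cexp_opp, Cexp_Ci_PI.
  replace (/ RtoC (-1))%C with (RtoC (-1)).
  2:{ rewrite <- RtoC_inv by lra; f_equal; field. }
  replace (RtoC (-1)) with (- (1))%C by (rewrite <- RtoC_opp; f_equal; ring); ring.
Qed.

Lemma is_hankel_mul_id (f : C -> C) (x l : C) :
  is_hankel f (x - 1) l -> is_hankel (fun s => s * f s)%C x (- l)%C.
Proof.
  intros [l1 [l2 [l3 [H1 [H2 [H3 ->]]]]]].
  exists (RtoC (-1) * l1)%C, (RtoC (-1) * l2)%C, (RtoC (-1) * l3)%C.
  assert (E1 : RtoC (-1) = (- (1))%C) by (rewrite <- RtoC_opp; f_equal; ring).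
  assert (Ex : x = (x - 1 + 1)%C) by ring.
  assert (Hray : forall al l, edge_arg al -> is_RInt_ray (hankel_ray f (x - 1) al) l ->
    is_RInt_ray (hankel_ray (fun s => s * f s)%C x al) (RtoC (-1) * l)%C).
  { intros al l Hal Hl; apply is_RInt_ray_Cmult with (c := RtoC (-1)) in Hl.
    apply is_RInt_ray_ext with (2 := Hl); intros t Ht.
    rewrite !hankel_ray_eq, <- (ray_power_shift (x - 1) al t) by (auto; lra).
    rewrite <- Ex, RtoC_opp, E1; ring. }
  split; [apply Hray; auto; left; auto|split; [|split; [apply Hray; auto; right; auto|rewrite E1; ring]]].
  apply is_RInt_Cmult with (c := RtoC (-1)) in H2.
  apply is_RInt_ext with (2 := H2); intros t _; match goal with |- ?l = ?r => change (@eq C l r) end.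
  unfold hankel_circle; rewrite !hankel_integrand_circle.
  replace (circle_power (x - 1) t) with (- (Cexp (Ci * RtoC t) * circle_power x t))%C.
  2:{ rewrite Ex at 1; rewrite circle_power_shift; ring. }
  rewrite E1; ring.
Qed.

Lemma continuous_ray_power (x : C) (al t : R) : 0 < t ->
  continuous (U := C_UniformSpace) (ray_power x al) t.
Proof.
  intros Ht; apply (continuous_comp (V := C_UniformSpace) (W := C_UniformSpace)
    (fun t => (- x - 1) * (RtoC (ln t) + Ci * RtoC (al - PI)))%C Cexp); [|apply continuous_Cexp].
  apply continuous_Cmult; [apply continuous_const|].
  apply continuous_Cplus; [|apply continuous_const].
  apply continuous_RtoC, continuous_ln; auto.
Qed.

Lemma continuous_circle_point (t : R) :
  continuous (U := C_UniformSpace) (fun t => Cexp (Ci * RtoC t)) t.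
Proof.
  apply (continuous_comp (V := C_UniformSpace) (W := C_UniformSpace) (fun t => Ci * RtoC t)%C Cexp);
    [|apply continuous_Cexp].
  apply continuous_Cmult; [apply continuous_const|apply continuous_RtoC, (continuous_id (U := R_UniformSpace))].
Qed.

Lemma continuous_circle_power (x : C) (t : R) :
  continuous (U := C_UniformSpace) (circle_power x) t.
Proof.
  apply (continuous_comp (V := C_UniformSpace) (W := C_UniformSpace)
    (fun t => (- x - 1) * (Ci * RtoC (t - PI)))%C Cexp); [|apply continuous_Cexp].
  apply continuous_Cmult; [apply continuous_const|].
  apply continuous_Cmult; [apply continuous_const|].
  apply continuous_RtoC, (continuous_minus (V := R_NormedModule));
    [apply continuous_id|apply continuous_const].
Qed.

Lemma continuous_neg_axis (g : C -> C) (t : R) : ccont g ->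
  continuous (U := C_UniformSpace) (fun t => g (RtoC (- t))) t.
Proof.
  intros Hg; apply (continuous_comp (V := C_UniformSpace) (W := C_UniformSpace) (fun t => RtoC (- t)) g); auto.
  apply continuous_RtoC, (continuous_opp (V := R_NormedModule)), continuous_id.
Qed.

Lemma continuous_ray_product (g : C -> C) (x : C) (al t : R) : ccont g -> 0 < t ->
  continuous (U := C_UniformSpace) (fun t => g (RtoC (- t)) * Cexp (RtoC (- t)) * ray_power x al t)%C t.
Proof.
  intros Hg Ht; apply continuous_Cmult; [|apply continuous_ray_power; auto].
  apply continuous_Cmult; apply continuous_neg_axis; auto using continuous_Cexp.
Qed.

Lemma continuous_hankel_circle (g : C -> C) (x : C) (t : R) : ccont g ->
  continuous (U := C_UniformSpace) (hankel_circle g x) t.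
Proof.
  intros Hg.
  apply (continuous_ext (U := C_UniformSpace)
   (fun t => g (Cexp (Ci * RtoC t)) * Cexp (Cexp (Ci * RtoC t)) * circle_power x t * (Ci * Cexp (Ci * RtoC t)))%C).
  { intros s; unfold hankel_circle; rewrite hankel_integrand_circle; reflexivity. }
  assert (Hp := continuous_circle_point t).
  apply continuous_Cmult; [|apply continuous_Cmult; [apply continuous_const|auto]].
  apply continuous_Cmult; [|apply continuous_circle_power].
  apply continuous_Cmult;
    [apply (continuous_comp (V := C_UniformSpace) (W := C_UniformSpace) (fun t => Cexp (Ci * RtoC t)) g)
    |apply (continuous_comp (V := C_UniformSpace) (W := C_UniformSpace) (fun t => Cexp (Ci * RtoC t)) Cexp)];
    auto using continuous_Cexp.
Qed.

(** The growth condition gives [|f (-t)| <= exp (m t)] for large [t], so [exp (-t)] leaves the rate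
    [1 - m]. Half of it absorbs the power of [t], the other half is the decay that remains. *)
Lemma hankel_ray_decay (f : C -> C) (x : C) (al : R) : in_Od f ->
  exists c K T, 0 < c /\ 0 <= K /\ forall t, T <= t ->
    0 < t /\ Cmod (hankel_ray f x al t) <= K * exp (- c * t).
Proof.
  intros [_ [m [Hm Hlim]]].
  apply is_lim_spec in Hlim.
  destruct (Hlim (mkposreal 1 Rlt_0_1)) as [M HM]; simpl in HM.
  set (A := Rabs (Re x + 1)); assert (HA : 0 <= A) by apply Rabs_pos.
  (* The bound [ln t <= d * t - 1 - ln d] holds for every [d > 0]. This [d] makes
     [A * d <= (1 - m) / 2], with [A + 1] guarding against [A = 0]; [C0] collects the terms free of
     [t]. *)
  set (d := (1 - m) / (2 * (A + 1))).
  assert (Hd : 0 < d) by (apply Rdiv_lt_0_compat; lra).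
  set (C0 := A * (- 1 - ln d) + Rabs (Im x * (al - PI))).
  exists ((1 - m) / 2), (exp C0), (Rmax 1 (1 - M)); split; [lra|split; [apply Rlt_le, exp_pos|]].
  intros t Ht.
  assert (Ht1 : 1 <= t) by (eapply Rle_trans; [apply Rmax_l|exact Ht]).
  assert (HtM : 1 - M <= t) by (eapply Rle_trans; [apply Rmax_r|exact Ht]).
  split; [lra|].
  rewrite hankel_ray_eq by lra; rewrite !Cmod_mult; unfold ray_power; rewrite !Cmod_Cexp.
  assert (Hf : Cmod (f (RtoC (- t))) <= exp (m * t)).
  { specialize (HM (- t) ltac:(lra)).
    rewrite Rminus_0_r in HM; apply Rabs_def2 in HM; destruct HM as [HM _].
    replace (m * - t) with (- (m * t)) in HM by ring; rewrite exp_Ropp in HM.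
    pose proof (exp_pos (m * t)).
    apply Rmult_lt_compat_r with (r := exp (m * t)) in HM; auto.
    rewrite Rmult_assoc, Rinv_l in HM by lra; lra. }
  assert (Hln : 0 <= ln t) by (rewrite <- ln_1; apply ln_le; lra).
  assert (Hln2 : ln t <= d * t - 1 - ln d).
  { pose proof (ln_le_sub_1 (d * t) ltac:(apply Rmult_lt_0_compat; lra)).
    rewrite ln_mult in H by lra; lra. }
  apply Rle_trans with (exp (m * t) * exp (- t) * exp (A * (d * t - 1 - ln d) + Rabs (Im x * (al - PI)))).
  - apply Rmult_le_compat; try (apply Rlt_le, exp_pos).
    + apply Rmult_le_pos; [apply Cmod_ge_0|apply Rlt_le, exp_pos].
    + apply Rmult_le_compat_r; [apply Rlt_le, exp_pos|auto].
    + replace (Re ((- x - 1) * (RtoC (ln t) + Ci * RtoC (al - PI)))) with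
        (- (Re x + 1) * ln t + Im x * (al - PI)) by (unfold Re, Im; simpl; ring).
      assert (H1 : - (Re x + 1) * ln t <= A * ln t).
      { apply Rmult_le_compat_r; auto; unfold A; rewrite <- Rabs_Ropp; apply Rle_abs. }
      assert (H2 : A * ln t <= A * (d * t - 1 - ln d)) by (apply Rmult_le_compat_l; auto).
      pose proof (Rle_abs (Im x * (al - PI))).
      assert (H3 : - (Re x + 1) * ln t + Im x * (al - PI) <= A * (d * t - 1 - ln d) + Rabs (Im x * (al - PI))) by lra.
      destruct H3 as [H3|H3]; [left; apply exp_increasing; auto|rewrite H3; lra].
  - rewrite <- !exp_plus.
    assert (Hdt : A * (d * t) <= (1 - m) / 2 * t).
    { rewrite <- Rmult_assoc; apply Rmult_le_compat_r; [lra|].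
      apply Rle_trans with ((A + 1) * d); [apply Rmult_le_compat_r; lra|].
      right; unfold d; field; lra. }
    assert (H3 : m * t + - t + (A * (d * t - 1 - ln d) + Rabs (Im x * (al - PI))) <= C0 + - ((1 - m) / 2) * t).
    { unfold C0; lra. }
    destruct H3 as [H3|H3]; [left; apply exp_increasing; auto|rewrite H3; lra].
Qed.

(** Removes the boundary term at infinity in the integration by parts. *)
Lemma hankel_ray_lim_0 (f : C -> C) (x : C) (al : R) : in_Od f ->
  filterlim (hankel_ray f x al) (Rbar_locally p_infty) (locally (T := C_UniformSpace) (RtoC 0)).
Proof.
  intros Hf; destruct (hankel_ray_decay f x al Hf) as [c [K [T [Hc [HK HT]]]]].
  intros P HP; apply locally_C_Cmod in HP; destruct HP as [e [e0 He]].
  destruct (Rexp_decay c K e Hc HK e0) as [S HS].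
  exists (Rmax T S); intros t Ht; apply He.
  replace (hankel_ray f x al t - 0)%C with (hankel_ray f x al t) by ring.
  pose proof (Rmax_l T S); pose proof (Rmax_r T S).
  eapply Rle_lt_trans; [apply HT; lra|apply HS; lra].
Qed.

Lemma ex_hankel (f : C -> C) (x : C) : in_Od f -> exists l, is_hankel f x l.
Proof.
  intros Hf.
  assert (Hc : ccont f) by (intros z; apply entire_continuous, Hf).
  assert (Hray : forall al, exists l, is_RInt_ray (hankel_ray f x al) l).
  { intros al; destruct (hankel_ray_decay f x al Hf) as [c [K [T [Hc0 [HK HT]]]]].
    destruct (ex_RInt_ray (fun t => f (RtoC (- t)) * Cexp (RtoC (- t)) * ray_power x al t)%C c K T Hc0 HK) as [l Hl].
    - intros t Ht; apply continuous_ray_product; auto; lra.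
    - intros t Ht; destruct (HT t Ht) as [Ht0 H]; rewrite hankel_ray_eq in H; auto.
    - exists l; apply is_RInt_ray_ext with (2 := Hl); intros t Ht; rewrite hankel_ray_eq; auto; lra. }
  destruct (Hray (- PI)) as [l1 H1]; destruct (Hray PI) as [l3 H3].
  exists (l1 + RI (hankel_circle f x) (- PI) PI - l3)%C, l1, (RI (hankel_circle f x) (- PI) PI), l3.
  repeat split; auto; apply is_RInt_RI; intros; apply continuous_hankel_circle; auto.
Qed.

(** * Integration by parts along the contour *)

Local Notation is_Rderive := (is_derive (K := R_AbsRing) (V := C_R_NormedModule)).

Lemma is_derive_neg_axis (t : R) : is_Rderive (fun t => RtoC (- t)) t (RtoC (-1)).
Proof. apply is_derive_RtoC; auto_derive; auto; ring. Qed.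

Lemma is_derive_ray_power (x : C) (al t : R) : 0 < t ->
  is_Rderive (ray_power x al) t (ray_power x al t * ((- x - 1) * RtoC (/ t)))%C.
Proof.
  intros Ht; apply is_derive_Cexp_R.
  replace ((- x - 1) * RtoC (/ t))%C with
    (RtoC 0 * (RtoC (ln t) + Ci * RtoC (al - PI)) + (- x - 1) * (RtoC (/ t) + 0))%C by ring.
  apply (is_derive_Cmult_R (fun _ => - x - 1)%C (fun t => RtoC (ln t) + Ci * RtoC (al - PI))%C).
  - apply (is_derive_const (K := R_AbsRing) (V := C_R_NormedModule)).
  - apply (is_derive_plus (K := R_AbsRing) (V := C_R_NormedModule)).
    + apply is_derive_RtoC, is_derive_ln; auto.
    + apply (is_derive_const (K := R_AbsRing) (V := C_R_NormedModule)).
Qed.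

(** The common sign is that of [ds = - dt]. The third term differentiates the power, its [/ t] being
    absorbed by raising [x] to [x + 1]. *)
Lemma is_derive_ray_product (f : C -> C) (x : C) (al t : R) : entire f -> edge_arg al -> 0 < t ->
  is_Rderive (fun t => f (RtoC (- t)) * Cexp (RtoC (- t)) * ray_power x al t)%C t
    (- (C_derive f (RtoC (- t)) * Cexp (RtoC (- t)) * ray_power x al t
        + f (RtoC (- t)) * Cexp (RtoC (- t)) * ray_power x al t
        + (x + 1) * (f (RtoC (- t)) * Cexp (RtoC (- t)) * ray_power (x + 1) al t)))%C.
Proof.
  intros Hf Hal Ht.
  assert (E1 : RtoC (-1) = (- (1))%C) by (rewrite <- RtoC_opp; f_equal; ring).
  assert (H1 : is_Rderive (fun t => f (RtoC (- t))) t (C_derive f (RtoC (- t)) * RtoC (-1))%C).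
  { apply (is_derive_C_comp_R f (fun t => RtoC (- t))); [|apply is_derive_neg_axis].
    apply (C_derive_correct f _ (RtoC 0)), Hf. }
  assert (H2 := is_derive_Cexp_R _ t _ (is_derive_neg_axis t)).
  assert (H3 := is_derive_Cmult_R _ _ t _ _ (is_derive_Cmult_R _ _ t _ _ H1 H2) (is_derive_ray_power x al t Ht)).
  match type of H3 with is_derive _ _ ?d => match goal with |- is_derive _ _ ?e => replace e with d; [exact H3|] end end.
  rewrite <- (ray_power_shift x al t), RtoC_inv, E1 by (auto; lra).
  field; intros E; apply RtoC_inj in E; lra.
Qed.

(** The tangent [i s] is already part of [hankel_circle]. In the third term the minus of [- x - 1]
    meets that of [circle_power_shift], so all signs are positive. *)
Lemma is_derive_circle_product (f : C -> C) (x : C) (t : R) : entire f ->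
  is_Rderive (fun t => f (Cexp (Ci * RtoC t)) * Cexp (Cexp (Ci * RtoC t)) * circle_power x t)%C t
    (hankel_circle (C_derive f) x t + hankel_circle f x t + (x + 1) * hankel_circle f (x + 1) t)%C.
Proof.
  intros Hf.
  assert (H0 : forall c : C, is_Rderive (fun t => c * RtoC t)%C t c).
  { intros c; apply (is_derive_ext (K := R_AbsRing) (V := C_R_NormedModule) (fun t => RtoC t * c)%C).
    - intros s; apply Cmult_comm.
    - apply is_derive_Rscal. }
  assert (H1 := is_derive_Cexp_R _ t _ (H0 Ci)).
  assert (H2 := is_derive_Cexp_R _ t _ H1).
  assert (H3 : is_Rderive (fun t => f (Cexp (Ci * RtoC t))) t (C_derive f (Cexp (Ci * RtoC t)) * (Cexp (Ci * RtoC t) * Ci))%C).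
  { apply (is_derive_C_comp_R f (fun t => Cexp (Ci * RtoC t))); [|exact H1].
    apply (C_derive_correct f _ (RtoC 0)), Hf. }
  assert (H4 : is_Rderive (circle_power x) t (circle_power x t * ((- x - 1) * Ci))%C).
  { apply is_derive_Cexp_R.
    apply (is_derive_ext (K := R_AbsRing) (V := C_R_NormedModule)
      (fun t => (- x - 1) * Ci * RtoC t + - ((- x - 1) * Ci * RtoC PI))%C).
    - intros s; rewrite RtoC_minus; match goal with |- ?l = ?r => change (@eq C l r) end; ring.
    - assert (HQ := is_derive_plus (K := R_AbsRing) (V := C_R_NormedModule) _ _ t _ _ (H0 ((- x - 1) * Ci)%C)
        (is_derive_const (K := R_AbsRing) (V := C_R_NormedModule) (- ((- x - 1) * Ci * RtoC PI))%C t)).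
      replace (plus (G := C_R_NormedModule) ((- x - 1) * Ci)%C zero) with ((- x - 1) * Ci)%C in HQ; [exact HQ|].
      symmetry; apply (plus_zero_r (G := C_R_NormedModule)). }
  assert (H5 := is_derive_Cmult_R _ _ t _ _ (is_derive_Cmult_R _ _ t _ _ H3 H2) H4).
  match type of H5 with is_derive _ _ ?d => match goal with |- is_derive _ _ ?e => replace e with d; [exact H5|] end end.
  unfold hankel_circle; rewrite !hankel_integrand_circle.
  replace (circle_power x t) with (- (Cexp (Ci * RtoC t) * circle_power (x + 1) t))%C by (rewrite circle_power_shift; ring).
  ring.
Qed.

(* Integration by parts; the boundary terms at [s = -1] cancel between the three pieces of the contour. *)
Lemma is_hankel_derive (f : C -> C) (x l l' : C) : in_Od f ->
  is_hankel f x l -> is_hankel f (x + 1) l' ->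
  is_hankel (C_derive f) x (- l - (x + 1) * l')%C.
Proof.
  intros HO [l1 [l2 [l3 [H1 [H2 [H3 ->]]]]]] [m1 [m2 [m3 [K1 [K2 [K3 ->]]]]]].
  assert (Hf : entire f) by apply HO.
  assert (cf : ccont f) by (intros z; apply entire_continuous, Hf).
  assert (cdf : ccont (C_derive f)) by (intros z; apply entire_continuous_derive, Hf).
  (* Boundary value at [s = -1] reached with argument [al]. The branches at [- PI] and [PI] give
     different values in general, so the two are kept apart. *)
  set (g := fun al => (f (RtoC (-1)) * Cexp (RtoC (-1)) * Cexp ((- x - 1) * (Ci * RtoC (al - PI))))%C).
  assert (Hray : forall al l m, edge_arg al -> is_RInt_ray (hankel_ray f x al) l ->
    is_RInt_ray (hankel_ray f (x + 1) al) m ->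
    is_RInt_ray (hankel_ray (C_derive f) x al) (g al - l - (x + 1) * m)%C).
  { intros al l m Hal Hl Hm.
    set (F := fun t => (f (RtoC (- t)) * Cexp (RtoC (- t)) * ray_power x al t)%C).
    set (D := fun t => (C_derive f (RtoC (- t)) * Cexp (RtoC (- t)) * ray_power x al t
        + f (RtoC (- t)) * Cexp (RtoC (- t)) * ray_power x al t
        + (x + 1) * (f (RtoC (- t)) * Cexp (RtoC (- t)) * ray_power (x + 1) al t))%C).
    assert (HF1 : F 1 = g al).
    { unfold F, g, ray_power; rewrite ln_1; f_equal; f_equal; ring. }
    (* Since [D = - F'], the integral up to [b] is [F 1 - F b], and [F b] tends to 0. *)
    assert (HD : is_RInt_ray D (g al)).
    { apply is_RInt_ray_of_lim with (fun b => F 1 - F b)%C.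
      - intros b Hb; replace (F 1 - F b)%C with (- F b - - F 1)%C by ring.
        apply (is_RInt_derive (V := C_R_CompleteNormedModule) (fun t => - F t)%C); rewrite Rmin_left by auto; intros t Ht.
        + replace (D t) with (opp (G := C_R_NormedModule) (- D t)%C).
          2:{ change (- - D t = D t)%C; ring. }
          apply (is_derive_opp (K := R_AbsRing) (V := C_R_NormedModule) F).
          apply is_derive_ray_product; auto; lra.
        + apply continuous_Cplus; [apply continuous_Cplus; apply continuous_ray_product; auto; lra|].
          apply continuous_Cmult; [apply continuous_const|apply continuous_ray_product; auto; lra].
      - intros P HP.
        assert (Hc : continuous (T := C_UniformSpace) (U := C_UniformSpace) (fun z => F 1 - z)%C (RtoC 0)).
        { apply continuous_Cminus; [apply continuous_const|apply continuous_id]. }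
        assert (HP' : locally (T := C_UniformSpace) (F 1 - 0)%C P).
        { replace (F 1 - 0)%C with (g al) by (rewrite HF1; ring); exact HP. }
        destruct (hankel_ray_lim_0 f x al HO _ (Hc P HP')) as [M HM].
        exists (Rmax 0 M); intros t Ht.
        pose proof (Rmax_l 0 M); pose proof (Rmax_r 0 M).
        unfold F at 2; rewrite <- hankel_ray_eq by lra; apply HM; lra. }
    assert (HS := is_RInt_gen_minus (V := C_R_NormedModule) _ _ _ _ (is_RInt_gen_minus (V := C_R_NormedModule) _ _ _ _ HD Hl)
       (is_RInt_ray_Cmult (x + 1)%C _ _ Hm)).
    apply is_RInt_ray_ext with (2 := HS); intros t Ht.
    change (D t - hankel_ray f x al t - (x + 1) * hankel_ray f (x + 1) al t = hankel_ray (C_derive f) x al t)%C.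
    rewrite !hankel_ray_eq by lra; unfold D; ring. }
  exists (g (- PI)%R - l1 - (x + 1) * m1)%C, (g PI - g (- PI)%R - l2 - (x + 1) * m2)%C, (g PI - l3 - (x + 1) * m3)%C.
  split; [apply Hray; auto; left; auto|split; [|split; [apply Hray; auto; right; auto|ring]]].
  assert (HD : is_RInt (V := C_R_NormedModule)
    (fun t => hankel_circle (C_derive f) x t + hankel_circle f x t + (x + 1) * hankel_circle f (x + 1) t)%C
    (- PI) PI (g PI - g (- PI)%R)%C).
  { assert (Hg : forall al, edge_arg al -> g al = (f (Cexp (Ci * RtoC al)) * Cexp (Cexp (Ci * RtoC al)) * circle_power x al)%C).
    { intros al Hal; rewrite edge_arg_Cexp by auto; reflexivity. }
    rewrite !Hg by (left; reflexivity) || (right; reflexivity).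
    apply (is_RInt_derive (V := C_R_CompleteNormedModule)
      (fun t => f (Cexp (Ci * RtoC t)) * Cexp (Cexp (Ci * RtoC t)) * circle_power x t)%C); intros t _.
    - apply is_derive_circle_product; auto.
    - apply continuous_Cplus; [apply continuous_Cplus; apply continuous_hankel_circle; auto|].
      apply continuous_Cmult; [apply continuous_const|apply continuous_hankel_circle; auto]. }
  assert (HS := is_RInt_minus (V := C_R_NormedModule) _ _ _ _ _ _ (is_RInt_minus (V := C_R_NormedModule) _ _ _ _ _ _ HD H2)
       (is_RInt_Cmult (x + 1)%C _ _ _ _ K2)).
  apply is_RInt_ext with (2 := HS); intros t _.
  change (hankel_circle (C_derive f) x t + hankel_circle f x t + (x + 1) * hankel_circle f (x + 1) t
    - hankel_circle f x t - (x + 1) * hankel_circle f (x + 1) t = hankel_circle (C_derive f) x t)%C.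
  ring.
Qed.

(** * The prefactor and the two intertwining identities *)

Definition Nop_factor (x : C) : C :=
  (Cexp (- (Ci * RtoC PI * x)) / (2 * Ci * Csin (RtoC PI * x) * CGamma (- x)))%C.

Lemma Cinv_0 : (/ 0 = 0)%C.
Proof. apply C_eq; unfold Re, Im; simpl; unfold Rdiv; ring. Qed.

(* If a denominator vanishes, both sides are [0] because [/ 0 = 0]. *)
Lemma Nop_factor_succ (x : C) : not_integer x -> Nop_factor (x + 1) = (- (x + 1) * Nop_factor x)%C.
Proof.
  intros Hx; unfold Nop_factor.
  (* The Gamma recurrence is applied at [- (x + 1)]; a vanishing factor there would make [x] the
     integer [n - 1]. *)
  assert (Hz : forall n : nat, (- (x + 1) + RtoC (INR n))%C <> RtoC 0).
  { intros n E; apply (Hx (Z.of_nat n - 1)%Z).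
    rewrite minus_IZR, <- INR_IZR_INZ, RtoC_minus.
    replace (RtoC (INR n)) with ((- (x + 1) + RtoC (INR n)) + x + 1)%C at 1 by ring.
    rewrite E; ring. }
  assert (HG : CGamma (- x) = (- (x + 1) * CGamma (- (x + 1)))%C).
  { rewrite <- CGamma_succ by exact Hz; f_equal; ring. }
  assert (Em : RtoC (-1) = (- (1))%C) by (rewrite <- RtoC_opp; f_equal; ring).
  assert (Ei : (/ RtoC (-1))%C = RtoC (-1)) by (rewrite <- RtoC_inv by lra; f_equal; field).
  assert (HE : Cexp (- (Ci * RtoC PI * (x + 1))) = (- Cexp (- (Ci * RtoC PI * x)))%C).
  { replace (- (Ci * RtoC PI * (x + 1)))%C with (- (Ci * RtoC PI) + - (Ci * RtoC PI * x))%C by ring.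
    rewrite Cexp_plus, Cexp_opp, Cexp_Ci_PI, Ei, Em; ring. }
  assert (HS : Csin (RtoC PI * (x + 1)) = (- Csin (RtoC PI * x))%C).
  { unfold Csin; change Defs.Ci with Ci.
    replace (Ci * (RtoC PI * (x + 1)))%C with (Ci * RtoC PI + Ci * (RtoC PI * x))%C by ring.
    rewrite Copp_plus_distr, !Cexp_plus, (Cexp_opp (Ci * RtoC PI)), Cexp_Ci_PI, Ei, Em.
    unfold Cdiv; ring. }
  rewrite HE, HS, HG.
  assert (Hy : (- (x + 1))%C <> RtoC 0) by (specialize (Hz 0%nat); simpl in Hz; rewrite Cplus_0_r in Hz; exact Hz).
  set (y := (- (x + 1))%C) in *.
  set (S := Csin (RtoC PI * x)); set (G := CGamma y).
  destruct (Ceq_dec (S * G) 0) as [H0|H0].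
  - replace (2 * Ci * - S * G)%C with (- (2 * Ci) * (S * G))%C by ring.
    replace (2 * Ci * S * (y * G))%C with ((2 * Ci * y) * (S * G))%C by ring.
    rewrite H0, !Cmult_0_r; unfold Cdiv; rewrite Cinv_0; ring.
  - field; repeat split; auto using Ci_nz; intros E; apply H0; rewrite E; ring.
Qed.

Lemma Nop_eq (f : C -> C) (x l : C) : is_hankel f x l -> Nop f x = (Nop_factor x * l)%C.
Proof. intros H; unfold Nop; rewrite (is_hankel_unique f x l H); reflexivity. Qed.

Theorem mainTheorem10 :
  (forall (f g : C -> C) (a b : C), in_Od f -> in_Od g ->
     forall x : C, not_integer x ->
       Nop (fun s => a * f s + b * g s)%C x = (a * Nop f x + b * Nop g x)%C)
  /\
  (forall f : C -> C, in_Od f ->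
     forall x : C, not_integer x ->
       Nop (C_derive f) x = (Nop f (x + 1) - Nop f x)%C /\
       Nop (fun s => s * f s)%C x = (x * Nop f (x - 1))%C).
Proof.
  split.
  - intros f g a b Hf Hg x _.
    destruct (ex_hankel f x Hf) as [l Hl]; destruct (ex_hankel g x Hg) as [m Hm].
    rewrite (Nop_eq _ _ _ (is_hankel_linear f g a b x l m Hl Hm)), (Nop_eq _ _ _ Hl), (Nop_eq _ _ _ Hm).
    ring.
  - intros f Hf x Hx.
    destruct (ex_hankel f x Hf) as [l Hl].
    destruct (ex_hankel f (x + 1)%C Hf) as [l' Hl'].
    destruct (ex_hankel f (x - 1)%C Hf) as [m Hm].
    split.
    + rewrite (Nop_eq _ _ _ (is_hankel_derive f x l l' Hf Hl Hl')), (Nop_eq _ _ _ Hl), (Nop_eq _ _ _ Hl').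
      rewrite Nop_factor_succ by auto; ring.
    + rewrite (Nop_eq _ _ _ (is_hankel_mul_id f x m Hm)), (Nop_eq _ _ _ Hm).
      (* Multiplication by [s] moves [x] down, so the prefactor recurrence is used at [x - 1], where
         it reads [c(x) = - x c(x - 1)]; its sign cancels that of the contour integral. *)
      assert (Hx1 : not_integer (x - 1)%C).
      { intros n E; apply (Hx (n + 1)%Z); rewrite plus_IZR, RtoC_plus, <- E; ring. }
      replace (Nop_factor x) with (Nop_factor (x - 1 + 1)%C) by (f_equal; ring).
      rewrite Nop_factor_succ by auto; ring.
Qed.
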